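(* Let $C>0$, suppose that $x\mapsto\log f(x;y)$ is $C$-Lipschitz on $\mathbb{R}^d$ and that, for some $\varepsilon>0$, $\|T(z)-\widehat T(z)\|\le\varepsilon$ for all $z\in\mathbb{R}^d$. Let $\widehat\psi^y$ be the reduced-dimension approximate posterior built with $\widehat T$ and $\widehat U_r$. Then $$\mathrm{D}_{\mathrm{Hell}}(\widehat\phi^y,\widehat\psi^y)^2\le\frac14\,\mathcal{R}(\widehat U_r,\widehat H),\qquad \mathrm{D}_{\mathrm{Hell}}(\phi^y,\widehat\psi^y)^2\le\frac14\,\mathcal{R}(\widehat U_r,\widehat H)+\mathcal{O}(\varepsilon)\quad(\varepsilon\to0),$$ where the constant implied in $\mathcal{O}(\varepsilon)$ may depend on the fixed data $C,d,T,f,y$, but not on $\varepsilon$, $\widehat T$, $r$ or $\widehat U_r$.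
   Context: Setting: $\phi^0$ denotes a standard Gaussian density (on $\mathbb{R}^d$, $\mathbb{R}^r$ or $\mathbb{R}^{d-r}$ according to its argument); $T:\mathbb{R}^d\to\mathbb{R}^d$ is a $C^1$ bijection pushing $\phi^0$ forward to a prior density, and $\widehat T:\mathbb{R}^d\to\mathbb{R}^d$ is a $C^1$ bijection approximating $T$. The function $x\mapsto f(x;y)>0$ is a continuously differentiable likelihood for a fixed data vector $y$. Define $$\phi^y(z)=\frac1{\mathcal Z}f(T(z);y)\phi^0(z),\quad \mathcal Z=\int_{\mathbb{R}^d}f(T(z);y)\phi^0(z)\,dz,\qquad \widehat\phi^y(z)=\frac1{\widehat{\mathcal Z}}f(\widehat T(z);y)\phi^0(z),\quad \widehat{\mathcal Z}=\int_{\mathbb{R}^d}f(\widehat T(z);y)\phi^0(z)\,dz,$$ with $\mathcal Z\in(0,\infty)$. Let $$\widehat H=\int_{\mathbb{R}^d}\nabla_z\log f(\widehat T(z);y)\,\nabla_z\log f(\widehat T(z);y)^T\,\widehat\phi^y(z)\,dz,$$ where $\nabla_z\log f(\widehat T(z);y)$ is the gradient of the composite function $z\mapsto\log f(\widehat T(z);y)$; $\widehat H$ is assumed to be well defined (finite trace). For a matrix $U\in\mathbb{R}^{d\times r}$ with orthonormal columns, put $\mathcal{R}(U,\widehat H)=\operatorname{trace}(\widehat H)-\operatorname{trace}(U^T\widehat H U)$. The matrix $\widehat U_r\in\mathbb{R}^{d\times r}$ has orthonormal columns and minimizes $U\mapsto\mathcal{R}(U,\widehat H)$ over all such matrices (its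 columns can be taken to be eigenvectors of $\widehat H$ for the $r$ largest eigenvalues). The matrix $\widehat U_\bot\in\mathbb{R}^{d\times(d-r)}$ has orthonormal columns with $\widehat U_r^T\widehat U_\bot=0$. The approximate posterior is $$\widehat\psi^y(z)=\frac1{\widehat{\mathcal Z}}\,\hat g(\widehat U_r^Tz;y)\,\phi^0(z),\qquad \hat g(z_r;y)=\int_{\mathbb{R}^{d-r}}f\big(\widehat T(\widehat U_rz_r+\widehat U_\bot z_\bot);y\big)\phi^0(z_\bot)\,dz_\bot .$$ The Hellinger distance between densities $p,q$ is $\mathrm{D}_{\mathrm{Hell}}(p,q)=\big(\tfrac12\int(\sqrt p-\sqrt q)^2\big)^{1/2}$. *)

(* Defs.v *)
From HB Require Import structures.
From mathcomp Require Import all_boot all_order all_algebra.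
From mathcomp Require Import all_classical all_reals all_analysis.

Set Implicit Arguments.
Unset Strict Implicit.
Unset Printing Implicit Defensive.
Import Order.TTheory GRing.Theory Num.Theory.
Import numFieldNormedType.Exports.
Local Open Scope classical_set_scope.
Local Open Scope ring_scope.

(* R^n is 'cV[R]_n, with the sigma-algebra generated by the coordinates (the
   Borel sets), as mathcomp-analysis does for n.-tuple R. *)
Definition cV_display : Type -> measure_display. Proof. exact. Qed.

Section measurable_cV.
Context {R : realType} {n : nat}.

Let coord (i : 'I_n) (x : 'cV[R]_n) : R := x i ord0.

Let cV_set0 : g_sigma_preimage coord set0.
Proof. exact: sigma_algebra0. Qed.

Let cV_setC A : g_sigma_preimage coord A -> g_sigma_preimage coord (~` A).
Proof. exact: sigma_algebraC. Qed.

Let cV_bigcup (F : (set _)^nat) : (forall i, g_sigma_preimage coord (F i)) ->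
  g_sigma_preimage coord (\bigcup_i F i).
Proof. exact: sigma_algebra_bigcup. Qed.

HB.instance Definition _ := @isMeasurable.Build (cV_display R)
  'cV[R]_n (g_sigma_preimage coord) cV_set0 cV_setC cV_bigcup.

End measurable_cV.

Lemma measurable_coord (R : realType) n (i : 'I_n) :
  measurable_fun [set: 'cV[R]_n] (fun x : 'cV[R]_n => x i ord0).
Proof.
move=> _ Y mY; rewrite setTI; apply: sub_sigma_algebra => /=.
rewrite -bigcup_seq/=; exists i => /=; first by rewrite mem_index_enum.
by exists Y => //; rewrite setTI.
Qed.

Lemma measurable_fun_cV (R : realType) n d (T : measurableType d)
    (f : T -> 'cV[R]_n) :
  (forall i, measurable_fun [set: T] (fun x => f x i ord0)) ->
  measurable_fun [set: T] f.
Proof.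
move=> mf.
have prefS : g_sigma_preimage (fun i x => f x i ord0) `<=` measurable.
  apply: smallest_sub; first exact: sigma_algebra_measurable.
  rewrite -bigcup_seq; apply: bigcup_sub => i _ A [B mB <-].
  exact: mf.
move=> _ A mA; apply: prefS.
rewrite (_ : g_sigma_preimage _ =
  preimage_set_system setT f (g_sigma_preimage (fun i (x : 'cV[R]_n) => x i ord0))).
  by exists A.
exact: (g_sigma_preimage_comp (fun i (x : 'cV[R]_n) => x i ord0) f).
Qed.

Section lebesgue_cV.
Context {R : realType}.

Definition cV_cons n (p : measurableTypeR R * 'cV[R]_n) : 'cV[R]_n.+1 :=
  \col_i (if unlift ord0 i is Some j then p.2 j ord0 else p.1).

Definition cV_uncons n (x : 'cV[R]_n.+1) : measurableTypeR R * 'cV[R]_n :=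
  (x ord0 ord0, \col_i x (lift ord0 i) ord0).

Lemma cV_consE0 n p : @cV_cons n p ord0 ord0 = p.1.
Proof. by rewrite mxE unlift_none. Qed.

Lemma cV_consES n p (i : 'I_n) : cV_cons p (lift ord0 i) ord0 = p.2 i ord0.
Proof. by rewrite mxE liftK. Qed.

Lemma cV_consK n : cancel (@cV_cons n) (@cV_uncons n).
Proof.
move=> [x v]; rewrite /cV_uncons cV_consE0; congr pair.
by apply/colP => i; rewrite mxE cV_consES.
Qed.

Lemma measurable_cV_cons n : measurable_fun setT (@cV_cons n).
Proof.
apply: measurable_fun_cV => i; have [j|] := unliftP ord0 i => ->.
  under eq_fun do rewrite cV_consES.
  by apply: (measurableT_comp (measurable_coord j)); exact: measurable_snd.
by under eq_fun do rewrite cV_consE0; exact: measurable_fst.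
Qed.

Lemma measurable_cV_uncons n : measurable_fun setT (@cV_uncons n).
Proof.
apply: measurable_fun_pair; first exact: measurable_coord.
apply: measurable_fun_cV => i.
by under eq_fun do rewrite mxE; exact: measurable_coord.
Qed.

HB.instance Definition _ n :=
  isMeasurableFun.Build _ _ _ _ (@cV_cons n) (@measurable_cV_cons n).

Section cV_step.
Variables (n : nat) (m : {sigma_finite_measure set 'cV[R]_n -> \bar R}).

Definition cV_step : set 'cV[R]_n.+1 -> \bar R :=
  pushforward (@lebesgue_measure R \x m)%E (@cV_cons n).

Let cV_step0 : cV_step set0 = 0%E. Proof. exact: measure0. Qed.

Let cV_step_ge0 A : (0 <= cV_step A)%E. Proof. exact: measure_ge0. Qed.

Let cV_step_sigma_additive : semi_sigma_additive cV_step.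
Proof. exact: measure_semi_sigma_additive. Qed.

HB.instance Definition _ := isMeasure.Build _ _ _ cV_step
  cV_step0 cV_step_ge0 cV_step_sigma_additive.

Let cV_step_sigma_finite : sigma_finite setT cV_step.
Proof.
have /sigma_finiteP[F [FT ndF Foo]] := sigma_finiteT (@lebesgue_measure R).
have /sigma_finiteP[G [GT ndG Goo]] := sigma_finiteT m.
exists (fun k => @cV_uncons n @^-1` (F k `*` G k)).
  rewrite -preimage_bigcup -[LHS](preimage_setT (@cV_uncons n)); congr (_ @^-1` _).
  apply/esym/seteqP; split=> // -[x v] _.
  have [j _ Fx] : (\bigcup_k F k) x by rewrite -FT.
  have [k _ Gv] : (\bigcup_k G k) v by rewrite -GT.
  exists (maxn j k) => //; split.
    by move: x Fx; exact/subsetPset/ndF/leq_maxl.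
  by move: v Gv; exact/subsetPset/ndG/leq_maxr.
move=> k; have [mF Fk] := Foo k; have [mG Gk] := Goo k; split.
  by rewrite -[X in measurable X]setTI; apply: measurable_cV_uncons => //;
    exact: measurableX.
rewrite /cV_step /pushforward -comp_preimage (_ : _ \o _ = id) ?preimage_id.
  by rewrite product_measure1E// lte_mul_pinfty// ge0_fin_numE.
by apply/funext => p; exact: cV_consK.
Qed.

HB.instance Definition _ := Measure_isSigmaFinite.Build _ _ _ cV_step
  cV_step_sigma_finite.

End cV_step.

(* n-dimensional Lebesgue measure; on R^0 it is the point mass. *)
Fixpoint lebesgue_cV n : {sigma_finite_measure set 'cV[R]_n -> \bar R} :=
  if n isn't n'.+1 then dirac (0 : 'cV[R]_0) else cV_step (lebesgue_cV n').

Lemma measurable_cV_box n (A : 'I_n -> set R) : (forall i, measurable (A i)) ->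
  measurable [set x : 'cV[R]_n | forall i, A i (x i ord0)].
Proof.
move=> mA; pose B i := [set x : 'cV[R]_n | A i (x i ord0)].
rewrite (_ : [set x | _] = \big[setI/setT]_(i < n) B i).
  apply: bigsetI_measurable => i _; rewrite -[X in measurable X]setTI.
  exact: measurable_coord.
rewrite -bigcap_seq; apply/seteqP; split=> x Ax i; first by move=> _; exact: Ax.
by apply: (Ax i); rewrite /= mem_index_enum.
Qed.

Lemma lebesgue_cV_box n (A : 'I_n -> set R) : (forall i, measurable (A i)) ->
  lebesgue_cV n [set x | forall i, A i (x i ord0)] =
  (\prod_(i < n) @lebesgue_measure R (A i))%E.
Proof.
elim: n A => [|n IHn] A mA.
  by rewrite big_ord0 /= diracE mem_set// => -[].
rewrite big_ord_recl -IHn// -product_measure1E; last 2 first.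
- exact: mA.
- exact: (measurable_cV_box (fun i => mA (lift ord0 i))).
congr ((lebesgue_measure \x lebesgue_cV n)%E _).
apply/seteqP; split=> p /=.
  by move=> Ap; split=> [|i]; rewrite -?cV_consE0 -?cV_consES; exact: Ap.
move=> [Ax Av] i; have [j|] := unliftP ord0 i => ->.
  by rewrite cV_consES; exact: Av.
by rewrite cV_consE0.
Qed.

End lebesgue_cV.

Section vectors.
Context {R : realType}.

(* The norm `|x| of 'cV[R]_n in mathcomp-analysis is the sup norm. *)
Definition norm2 n (x : 'cV[R]_n) : R := Num.sqrt (\sum_(i < n) x i ord0 ^+ 2).

Definition grad n (h : 'cV[R]_n -> R) (z : 'cV[R]_n) : 'cV[R]_n :=
  \col_i 'D_(delta_mx i ord0) h z.

(* In finite dimension, continuity of z |-> 'D_v F z for every v is continuity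
   of the differential z |-> 'd F z. *)
Definition C1 (V W : normedModType R) (F : V -> W) : Prop :=
  (forall z, differentiable F z) /\ (forall v, continuous (fun z => 'D_v F z)).

(* Standard Gaussian density on R^n. *)
Definition phi0 n (z : 'cV[R]_n) : R := \prod_(i < n) normal_pdf 0 1 (z i ord0).

Definition orthonormal_cols m n (U : 'M[R]_(m, n)) : Prop := U^T *m U = 1%:M.

Definition hellinger n (p q : 'cV[R]_n -> R) : R :=
  Num.sqrt (2^-1 * \int[lebesgue_cV n]_z (Num.sqrt (p z) - Num.sqrt (q z)) ^+ 2).

(* S pushes the standard Gaussian density forward to the density p. *)
Definition pushes_phi0_to n (S : 'cV[R]_n -> 'cV[R]_n) (p : 'cV[R]_n -> R) :=
  [/\ measurable_fun setT p, forall x, 0 <= p x &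
      forall A : set 'cV[R]_n, measurable A ->
        (\int[lebesgue_cV n]_(z in S @^-1` A) (phi0 z)%:E =
         \int[lebesgue_cV n]_(x in A) (p x)%:E)%E].

End vectors.

(* L is the likelihood x |-> f(x; y) for the fixed data y; S is T or its
   approximation. *)
Section posterior.
Context {R : realType} {d : nat}.
Variables (L : 'cV[R]_d -> R) (S : 'cV[R]_d -> 'cV[R]_d).

Definition evidence : \bar R :=
  (\int[lebesgue_cV d]_z (L (S z) * phi0 z)%:E)%E.

Definition posterior (z : 'cV[R]_d) : R :=
  (fine evidence)^-1 * L (S z) * phi0 z.

Definition score (z : 'cV[R]_d) : 'cV[R]_d :=
  grad (fun w => ln (L (S w))) z.

Definition Hmat : 'M[R]_d :=
  \matrix_(i, j) \int[lebesgue_cV d]_z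
    ((score z *m (score z)^T) i j * posterior z).

(* Finiteness of the trace makes every entry of Hmat an integral of an
   integrable function. *)
Definition Hmat_finite_trace : Prop :=
  (\sum_(i < d) \int[lebesgue_cV d]_z
    ((score z *m (score z)^T) i i * posterior z)%:E < +oo)%E.

Definition marginal r (U : 'M[R]_(d, r)) (V : 'M[R]_(d, d - r))
    (zr : 'cV[R]_r) : R :=
  \int[lebesgue_cV (d - r)]_zp (L (S (U *m zr + V *m zp)) * phi0 zp).

Definition reduced_posterior r (U : 'M[R]_(d, r)) (V : 'M[R]_(d, d - r))
    (z : 'cV[R]_d) : R :=
  (fine evidence)^-1 * marginal U V (U^T *m z) * phi0 z.

End posterior.

Definition residual (R : realType) d r (U : 'M[R]_(d, r)) (H : 'M[R]_d) : R :=
  \tr H - \tr (U^T *m H *m U).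

Definition residual_minimizer (R : realType) d r (U : 'M[R]_(d, r))
    (H : 'M[R]_d) : Prop :=
  orthonormal_cols U /\
  forall V : 'M[R]_(d, r), orthonormal_cols V -> residual U H <= residual V H.

(* That is an admissible approximation of T up to eps, and Ur, Up are bases
   of the reduced space and of its orthogonal complement. *)
Definition reduction_data (R : realType) d (L : 'cV[R]_d -> R)
    (T : 'cV[R]_d -> 'cV[R]_d) (eps : R) (That : 'cV[R]_d -> 'cV[R]_d)
    r (Ur : 'M[R]_(d, r)) (Up : 'M[R]_(d, d - r)) : Prop :=
  [/\ C1 That /\ bijective That,
      forall z, norm2 (T z - That z) <= eps,
      Hmat_finite_trace L That,
      (r <= d)%N /\ residual_minimizer Ur (Hmat L That) &
      orthonormal_cols Up /\ Ur^T *m Up = 0].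

(* Main.v *)
Require Import Defs.
From HB Require Import structures.
From mathcomp Require Import all_boot all_order all_algebra.
From mathcomp Require Import all_classical all_reals all_analysis.
From mathcomp Require Import measurable_realfun ring lra.

Set Implicit Arguments.
Unset Strict Implicit.
Unset Printing Implicit Defensive.
Import Order.TTheory GRing.Theory Num.Theory.
Import numFieldNormedType.Exports.
Local Open Scope classical_set_scope.
Local Open Scope ring_scope.

(** The approximate posterior replaces the likelihood factor [F = f o That] by
    its conditional Gaussian mean [G] given [Ur^T z].  On a fibre
    [b |-> Ur a + Up b], with [u = sqrt F], [m = E u] and [G = E u^2 >= m^2],
    [1/2 E (u - sqrt G)^2 = G - m sqrt G <= G - m^2 = Var u <= E |grad u|^2]
    by the Gaussian Poincare inequality, and
    [|grad u|^2 = 1/4 F |Up^T grad (log F)|^2]; integrating over [a] produces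
    [1/4 tr (Up^T H Up)], the residual.

    In dimension one, Poincare follows from [Var u <= E (u - u 0)^2] and from the
    pointwise Hardy-type bound
    [v^2 phi <= v'^2 phi - (v^2 phi / x)'], that is [(v' - v/x)^2 >= 0], for
    [v = u - u 0].  It tensorizes by the Efron-Stein inequality, which needs no
    differentiation under the integral.

    For the second bound, Lipschitz continuity of [log f] makes [f o T] and
    [f o That], hence both posteriors, comparable up to factors
    [exp (O (eps))], and
    [(p - q)^2 <= (1 + eps) (p' - q)^2 + (1 + 1/eps) (p - p')^2]
    combines this with the first bound. *)

(** * Integration *)

(** Three obstacles shape the development. The measures on column vectors are iterated products
    along coordinates, whereas the splitting [z = Ur a + Up b] is not aligned with them. Rotation
    invariance of the Gaussian measure is therefore obtained from the behaviour of Lebesgue measure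
    under injective linear maps.

    Only the total mass [Z] and the trace of [H] are known to be finite, so a fibre mass [G] is
    finite only almost everywhere. Inequalities on [\bar R] are hence written as sums of nonnegative
    terms, as in [E u^2 <= (E u)^2 + E |grad u|^2]. Tonelli then needs no integrability, and no
    difference of infinities arises.

    In the second bound the factor [1 + eps] multiplies the reduction error. The residual involves
    the derivative of [That], which sup-norm closeness to [T] does not control, so it cannot bound
    the extra [eps] part uniformly. The same error, as an integral of squared root differences, is
    also at most 2, whatever the map and the subspace. The perturbation error is of order [eps^2],
    which pays for the weight [1/eps]. *)

Section density.
Local Open Scope ereal_scope.
Context d (T : measurableType d) (R : realType).
Variables (mu nu : {measure set T -> \bar R}) (k : T -> R).
Hypotheses (mk : measurable_fun setT k) (k0 : forall x, (0 <= k x)%R).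
Hypothesis nuE : forall A, measurable A -> nu A = \int[mu]_(x in A) (k x)%:E.

Import HBNNSimple.

(** Monotone convergence along simple functions reduces the identity to indicators, where it is
    [nuE]. It serves to turn integrals against [normal_prob] into Lebesgue integrals with weight
    [normal_pdf]. *)
Lemma ge0_integral_density (f : T -> \bar R) :
  measurable_fun setT f -> (forall x, 0 <= f x) ->
  \int[nu]_x f x = \int[mu]_x (f x * (k x)%:E).
Proof.
move=> mf f0; pose f_ := nnsfun_approx measurableT mf.
have f_nd x : nondecreasing_seq (fun n => (f_ n x)%:E).
  by move=> m n mn; rewrite lee_fin; exact/lefP/nd_nnsfun_approx.
have f_cvg x : (f_ n x)%:E @[n --> \oo] --> f x.
  exact: (cvg_nnsfun_approx measurableT mf (fun x _ => f0 x)).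
have mEk : measurable_fun setT (fun x => (k x)%:E) by exact/measurable_EFinP.
transitivity (limn (fun n => \int[nu]_x (f_ n x)%:E)).
  rewrite -monotone_convergence//.
  - by apply: eq_integral => x _; apply/esym/cvg_lim.
  - by move=> n; exact/measurable_EFinP/measurable_funP.
  - by move=> n x _; rewrite lee_fin.
transitivity (limn (fun n => \int[mu]_x ((f_ n x)%:E * (k x)%:E))); last first.
  rewrite -monotone_convergence//.
  - apply: eq_integral => x _; apply/cvg_lim => //.
    by apply: cvgeZr.
  - by move=> n; apply: emeasurable_funM => //; exact/measurable_EFinP/measurable_funP.
  - by move=> n x _; rewrite mule_ge0// lee_fin.
  - by move=> x _ m n mn; rewrite lee_wpmul2r ?lee_fin ?k0//; exact: f_nd.
congr (limn _); apply/funext => n.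
under eq_integral do rewrite fimfunE -fsumEFin//.
rewrite [RHS](eq_integral (fun x => \sum_(r \in range (f_ n))
    ((r * \1_(f_ n @^-1` [set r]) x)%:E * (k x)%:E))); last first.
  move=> x _; rewrite fimfunE -fsumEFin// ge0_mule_fsuml// => r.
  exact: nnfun_muleindic_ge0.
have m1 r : measurable_fun setT (fun x => (r * \1_(f_ n @^-1` [set r]) x)%:E).
  exact/measurable_EFinP/measurable_funM.
have p1 r x : 0 <= (r * \1_(f_ n @^-1` [set r]) x)%:E.
  exact: nnfun_muleindic_ge0.
rewrite !ge0_integral_fsum//; last 2 first.
- by move=> r; exact: emeasurable_funM.
- by move=> r x _; rewrite mule_ge0// lee_fin.
apply: eq_fsbigr => r _.
rewrite integralZl_indic_nnsfun// integral_indic// setIT.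
have [r0|r0] := ltP r 0%R.
  rewrite preimage_nnfun0// measure0 mule0 integral0_eq// => x _.
  by rewrite indic0 /= mulr0 mul0e.
under [RHS]eq_integral do rewrite EFinM -muleA.
rewrite ge0_integralZl//; last 2 first.
- by apply: emeasurable_funM => //; exact/measurable_EFinP.
- by move=> x _; rewrite mule_ge0// lee_fin.
congr (_ * _); rewrite nuE// integral_mkcond; apply: eq_integral => x _.
by rewrite epatch_indic muleC.
Qed.

End density.

Section integralT.
Local Open Scope ereal_scope.
Context d (T : measurableType d) (R : realType).
Variable mu : {measure set T -> \bar R}.
Implicit Types f g : T -> \bar R.

Lemma ge0_integralTZl f k : measurable_fun setT f -> (forall x, 0 <= f x) ->
  0 <= k -> \int[mu]_x (k * f x) = k * \int[mu]_x f x.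
Proof. by move=> mf f0 k0; rewrite ge0_integralZl. Qed.

Lemma ge0_integralTD f g : measurable_fun setT f -> (forall x, 0 <= f x) ->
  measurable_fun setT g -> (forall x, 0 <= g x) ->
  \int[mu]_x (f x + g x) = \int[mu]_x f x + \int[mu]_x g x.
Proof. by move=> mf f0 mg g0; rewrite ge0_integralD. Qed.

Lemma ge0_le_integralT f g : measurable_fun setT f -> (forall x, 0 <= f x) ->
  measurable_fun setT g -> (forall x, f x <= g x) ->
  \int[mu]_x f x <= \int[mu]_x g x.
Proof. by move=> mf f0 mg fg; apply: ge0_le_integral. Qed.

End integralT.

Lemma integral_probability_cst d (T : measurableType d) (R : realType)
    (P : probability T R) (r : \bar R) : (\int[P]_x r)%E = r.
Proof.
transitivity (r * P setT)%E; first exact: integral_cst.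
by rewrite probability_setT mule1.
Qed.

(** * The standard Gaussian measure on column vectors *)

Section gauss.
Context {R : realType}.
Local Open Scope ereal_scope.

(** The recursion mirrors that of [lebesgue_cV]. Total mass 1 comes with the construction, and
    [integral_gauss] identifies [phi0] as the density. *)
Fixpoint gauss n : probability 'cV[R]_n R :=
  if n isn't n'.+1 then dirac (0%R : 'cV[R]_0)
  else distribution (normal_prob 0%R 1%R \x gauss n') (@cV_cons R n').

Lemma measurable_cV_consx n (x : R) :
  measurable_fun setT (fun v : 'cV[R]_n => cV_cons (x, v)).
Proof. exact: (measurableT_comp (@measurable_cV_cons R n)). Qed.

Lemma measurable_cV_consv n (v : 'cV[R]_n) :
  measurable_fun setT (fun x : R => cV_cons (x, v)).
Proof. exact: (measurableT_comp (@measurable_cV_cons R n)). Qed.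

Lemma integral_gaussS n (g : 'cV[R]_n.+1 -> \bar R) :
  measurable_fun setT g -> (forall z, 0 <= g z) ->
  \int[gauss n.+1]_z g z =
  \int[normal_prob 0%R 1%R]_x \int[gauss n]_v g (cV_cons (x, v)).
Proof.
move=> mg g0; rewrite /= /distribution ge0_integral_pushforward//.
rewrite preimage_setT fubini_tonelli1//; last by move=> p; exact: g0.
exact: (measurableT_comp mg (@measurable_cV_cons R n)).
Qed.

Lemma integral_lebesgue_cVS n (g : 'cV[R]_n.+1 -> \bar R) :
  measurable_fun setT g -> (forall z, 0 <= g z) ->
  \int[lebesgue_cV n.+1]_z g z =
  \int[lebesgue_measure]_x \int[lebesgue_cV n]_v g (cV_cons (x, v)).
Proof.
move=> mg g0; rewrite /= /cV_step ge0_integral_pushforward//.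
rewrite preimage_setT fubini_tonelli1//; last by move=> p; exact: g0.
exact: (measurableT_comp mg (@measurable_cV_cons R n)).
Qed.

(** Having the first coordinate innermost suits maps that shift it by a function of the others, as
    in [scales_lebesgue_upper]. *)
Lemma integral_lebesgue_cVS_swap n (g : 'cV[R]_n.+1 -> \bar R) :
  measurable_fun setT g -> (forall z, 0 <= g z) ->
  \int[lebesgue_cV n.+1]_z g z =
  \int[lebesgue_cV n]_v \int[lebesgue_measure]_x g (cV_cons (x, v)).
Proof.
move=> mg g0; rewrite /= /cV_step ge0_integral_pushforward//.
rewrite preimage_setT fubini_tonelli2//; last by move=> p; exact: g0.
exact: (measurableT_comp mg (@measurable_cV_cons R n)).
Qed.

Lemma phi0_cons n (x : R) (v : 'cV[R]_n) :
  phi0 (cV_cons (x, v)) = (normal_pdf 0 1 x * phi0 v)%R.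
Proof.
rewrite /phi0 big_ord_recl cV_consE0; congr (_ * _)%R.
by apply: eq_bigr => i _; rewrite cV_consES.
Qed.

Lemma normal_pdf01_gt0 (x : R) : (0 < normal_pdf 0 1 x)%R.
Proof.
by rewrite normal_pdfE ?oner_neq0// mulr_gt0 ?expR_gt0// normal_peak_gt0 ?oner_neq0.
Qed.

Lemma phi0_gt0 n (z : 'cV[R]_n) : (0 < phi0 z)%R.
Proof. by apply: prodr_gt0 => i _; exact: normal_pdf01_gt0. Qed.

Lemma measurable_phi0 n : measurable_fun setT (@phi0 R n).
Proof.
apply: measurable_prod => i _.
by apply: measurableT_comp; [exact: measurable_normal_pdf|exact: measurable_coord].
Qed.

Lemma integral_normal (f : R -> \bar R) :
  measurable_fun setT f -> (forall x, 0 <= f x) ->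
  \int[normal_prob 0%R 1%R]_x f x =
  \int[lebesgue_measure]_x (f x * (normal_pdf 0 1 x)%:E).
Proof.
move=> mf f0; apply: ge0_integral_density => //.
- exact: measurable_normal_pdf.
- by move=> x; exact/ltW/normal_pdf01_gt0.
Qed.

Lemma integral_gauss n (g : 'cV[R]_n -> \bar R) :
  measurable_fun setT g -> (forall z, 0 <= g z) ->
  \int[gauss n]_z g z = \int[lebesgue_cV n]_z (g z * (phi0 z)%:E).
Proof.
have phi_ge0 m (z : 'cV[R]_m) : 0 <= (phi0 z)%:E by rewrite lee_fin ltW// phi0_gt0.
have mphi m : measurable_fun setT (fun z : 'cV[R]_m => (phi0 z)%:E).
  by apply/measurable_EFinP; exact: (@measurable_phi0 m).
have mMphi m (h : 'cV[R]_m -> \bar R) : measurable_fun setT h ->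
    measurable_fun setT (fun z => h z * (phi0 z)%:E).
  by move=> mh; apply: emeasurable_funM; [exact: mh|exact: mphi].
elim: n g => [|n IHn] g mg g0.
  rewrite /= !integral_dirac//; last exact: mMphi.
  by rewrite /phi0 big_ord0 mule1.
rewrite integral_gaussS// integral_lebesgue_cVS//; last 2 first.
- exact: mMphi.
- by move=> z; rewrite mule_ge0.
rewrite integral_normal//; last 2 first.
- apply: (measurable_fun_fubini_tonelli_F (fun p => g (cV_cons p))) => //.
  exact: (measurableT_comp mg (@measurable_cV_cons R n)).
- by move=> x; exact: integral_ge0.
apply: eq_integral => x _.
have mgx : measurable_fun setT (fun v => g (cV_cons (x, v))).
  by apply: measurableT_comp => //; exact: measurable_cV_consx.
rewrite IHn// -ge0_integralZr//; last 3 first.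
- exact: mMphi.
- by move=> v _; rewrite mule_ge0.
- by rewrite lee_fin ltW// normal_pdf01_gt0.
apply: eq_integral => v _.
by rewrite phi0_cons EFinM -!muleA (muleC (phi0 v)%:E).
Qed.

Lemma measurable_mulmxl m n (A : 'M[R]_(m, n)) :
  measurable_fun setT (fun z : 'cV[R]_n => A *m z).
Proof.
apply: measurable_fun_cV => i; under eq_fun do rewrite mxE.
apply: measurable_sum => j; apply: measurable_funM => //.
exact: measurable_coord.
Qed.

Lemma measurable_addmx d (T : measurableType d) n (f g : T -> 'cV[R]_n) :
  measurable_fun setT f -> measurable_fun setT g ->
  measurable_fun setT (fun z => f z + g z)%R.
Proof.
move=> mf mg; apply: measurable_fun_cV => i; under eq_fun do rewrite mxE.
by apply: measurable_funD; apply: (measurableT_comp (measurable_coord i)).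
Qed.

Lemma col_mx_cons r k (x : R) (a : 'cV[R]_r) (b : 'cV[R]_k) :
  col_mx (cV_cons (x, a)) b = cV_cons (x, col_mx a b).
Proof.
apply/colP => i; rewrite -[i]fintype.splitK.
case: (@fintype.split r.+1 k i) => j /=.
  rewrite col_mxEu; have [l|] := unliftP ord0 j => ->.
    rewrite cV_consES (_ : lshift k (lift ord0 l) = lift ord0 (lshift k l)).
      by rewrite cV_consES col_mxEu.
    exact: val_inj.
  rewrite cV_consE0 (_ : lshift k ord0 = ord0) ?cV_consE0//.
  exact: val_inj.
rewrite col_mxEd (_ : rshift r.+1 j = lift ord0 (rshift r j)).
  by rewrite cV_consES col_mxEd.
exact: val_inj.
Qed.

Lemma measurable_col_mx r k :
  measurable_fun setT (fun p : 'cV[R]_r * 'cV[R]_k => col_mx p.1 p.2).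
Proof.
apply: measurable_fun_cV => i; rewrite -[i]fintype.splitK.
case: (fintype.split i) => j /=.
  under eq_fun do rewrite col_mxEu.
  exact: (measurableT_comp (measurable_coord j)).
under eq_fun do rewrite col_mxEd.
exact: (measurableT_comp (measurable_coord j)).
Qed.

(** Induction on [r]: both sides peel off the same first coordinate, since [col_mx] commutes with
    [cV_cons] in its upper block. No associativity of product measures is involved. *)
Lemma integral_gauss_split r k (g : 'cV[R]_(r + k) -> \bar R) :
  measurable_fun setT g -> (forall z, 0 <= g z) ->
  \int[gauss (r + k)]_z g z =
  \int[gauss r]_a \int[gauss k]_b g (col_mx a b).
Proof.
have mfib m (h : 'cV[R]_(m + k) -> \bar R) : measurable_fun setT h ->
    (forall z, 0 <= h z) ->
    measurable_fun setT (fun a => \int[gauss k]_b h (col_mx a b)).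
  move=> mh h0.
  apply: (measurable_fun_fubini_tonelli_F (fun p => h (col_mx p.1 p.2))) => //.
  by apply: measurableT_comp => //; exact: measurable_col_mx.
elim: r g => [|r IHr] g mg g0.
  rewrite /= integral_dirac//; last exact: mfib.
  rewrite diracT mul1e; apply: eq_integral => b _; congr (g _).
  apply/colP => i; rewrite -[i]fintype.splitK; case: (@fintype.split 0 k i) => [[]//|j] /=.
  by rewrite col_mxEd; congr (b _ _); exact: val_inj.
rewrite (integral_gaussS (n := r + k))// (integral_gaussS (n := r)); last 2 first.
- exact: mfib.
- by move=> a; exact: integral_ge0.
apply: eq_integral => x _.
under [RHS]eq_integral do under eq_integral do rewrite col_mx_cons.
rewrite IHr//; apply: measurableT_comp => //; exact: measurable_cV_consx.
Qed.

End gauss.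

(** * Linear changes of variables *)

Section linear_change_of_variables.
Context {R : realType}.
Local Open Scope ereal_scope.

Definition affine (a b : R) (x : measurableTypeR R) : measurableTypeR R :=
  (a * x + b)%R.

Lemma measurable_affine a b : measurable_fun setT (affine a b).
Proof. by apply: measurable_funD => //; apply: measurable_funM. Qed.

(** For positive [a], the measure [a] times the pushforward agrees with Lebesgue measure on
    half-open intervals, hence everywhere. A negative slope reduces to this case by reflection. *)
Lemma ge0_integral_affine (a b : R) (g : R -> \bar R) : a != 0%R ->
  measurable_fun setT g -> (forall x, 0 <= g x) ->
  \int[lebesgue_measure]_x g (a * x + b)%R =
  (`|a|^-1)%:E * \int[lebesgue_measure]_x g x.
Proof.
wlog a0 : a b g / (0 < a)%R => [hwlog|] an0 mg g0.
  have [a0|a0] := ltP 0%R a; first exact: hwlog.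
  have {}a0 : (0 < - a)%R by rewrite oppr_gt0 lt_neqAle an0.
  pose gN x := g (- x)%R.
  have mgN : measurable_fun setT gN by exact: measurableT_comp.
  transitivity (\int[lebesgue_measure]_x gN (- a * x + - b)%R).
    by apply: eq_integral => x _; rewrite /gN mulNr opprD !opprK.
  rewrite (hwlog (- a)%R (- b)%R gN)// ?gt_eqF//; last by move=> x; exact: g0.
  rewrite normrN; congr (_ * _).
  transitivity (\int[pushforward lebesgue_measure
    (-%R : measurableTypeR R -> measurableTypeR R)]_x g x).
    by rewrite ge0_integral_pushforward// preimage_setT.
  by apply: eq_measure_integral => A mA _; rewrite /= lebesgue_measureN.
pose F := affine a b.
have leb A : measurable A ->
    lebesgue_measure A = mscale (NngNum (ltW a0)) (pushforward lebesgue_measure F) A.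
  apply: lebesgue_measure_unique => _ [[p q]] _ <-.
  have FE : F @^-1` [set` `]p, q]%R] = [set` `](p - b) / a, (q - b) / a]%R].
    apply/seteqP; split=> x; rewrite /= !in_itv/= /F/affine.
      by rewrite ltr_pdivrMr// ler_pdivlMr// ltrBlDr lerBrDr mulrC.
    by rewrite ltr_pdivrMr// ler_pdivlMr// ltrBlDr lerBrDr mulrC.
  rewrite -[RHS]/(a%:E * lebesgue_measure (F @^-1` [set` `]p, q]%R])) FE.
  rewrite !lebesgue_measure_itv/= !lte_fin ltr_pM2r ?invr_gt0// ltrD2r.
  case: ifPn => _; last by rewrite mule0.
  by rewrite -!EFinB -EFinM; congr (_%:E); field.
transitivity (\int[pushforward lebesgue_measure F]_x g x).
  by rewrite (ge0_integral_pushforward (measurable_affine a b))// preimage_setT.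
have lebF : \int[lebesgue_measure]_x g x =
    \int[mscale (NngNum (ltW a0)) (pushforward lebesgue_measure F)]_x g x.
  by move=> mF; apply: eq_measure_integral => A mA _; exact: leb.
rewrite (lebF (measurable_affine a b)) ge0_integral_mscale//=.
by rewrite muleA -EFinM gtr0_norm// mulVf// mul1e.
Qed.

(** The constant [c] need not be identified: for an orthogonal map it is forced
    to be 1 by testing on the constant function 1 under the Gaussian measure. *)
Definition scales_lebesgue n (F : 'cV[R]_n -> 'cV[R]_n) :=
  measurable_fun setT F /\ exists2 c : R, (0 < c)%R &
    forall g : 'cV[R]_n -> \bar R, measurable_fun setT g ->
    (forall z, 0 <= g z) ->
    \int[lebesgue_cV n]_z g (F z) = c%:E * \int[lebesgue_cV n]_z g z.

Lemma scales_lebesgue_comp n (F G : 'cV[R]_n -> 'cV[R]_n) :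
  scales_lebesgue F -> scales_lebesgue G -> scales_lebesgue (F \o G).
Proof.
move=> [mF [c c0 Fc]] [mG [e e0 Ge]]; split; first exact: measurableT_comp.
exists (e * c)%R; first exact: mulr_gt0.
move=> g mg g0; rewrite EFinM -muleA -Fc//.
by rewrite -(Ge (fun z => g (F z)))//; exact: measurableT_comp.
Qed.

Lemma cV_unconsK n : cancel (@cV_uncons R n) (@cV_cons R n).
Proof.
move=> z; apply/colP => i; have [j|] := unliftP ord0 i => ->.
  by rewrite cV_consES mxE.
by rewrite cV_consE0.
Qed.

(** One coordinate at a time: the first is the slope 1 case of [ge0_integral_affine], the others are
    the induction hypothesis. *)
Lemma integral_lebesgue_cV_translation n (w : 'cV[R]_n) (g : 'cV[R]_n -> \bar R) :
  measurable_fun setT g -> (forall z, 0 <= g z) ->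
  \int[lebesgue_cV n]_z g (z + w)%R = \int[lebesgue_cV n]_z g z.
Proof.
elim: n w g => [|n IHn] w g mg g0.
  by apply: eq_integral => z _; congr g; apply/colP => -[].
have mT m (u : 'cV[R]_m) : measurable_fun setT (fun z : 'cV[R]_m => z + u)%R.
  exact: measurable_addmx.
rewrite (integral_lebesgue_cVS mg g0).
rewrite (integral_lebesgue_cVS (measurableT_comp mg (mT _ w)) (fun z => g0 _)).
pose w' := (cV_uncons w).2.
pose h x := \int[lebesgue_cV n]_v g (cV_cons (x, v)).
transitivity (\int[lebesgue_measure]_x h (1 * x + w ord0 ord0)%R).
  apply: eq_integral => x _; rewrite mul1r /h -[RHS](IHn w'); last 2 first.
  - by apply: (measurableT_comp mg); exact: measurable_cV_consx.
  - by move=> v; exact: g0.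
  apply: eq_integral => v _; congr g; apply/colP => i; rewrite mxE.
  have [j|] := unliftP ord0 i => ->; first by rewrite !cV_consES !mxE.
  by rewrite !cV_consE0.
rewrite ge0_integral_affine ?oner_neq0//.
- by rewrite normr1 invr1 mul1e.
- apply: (measurable_fun_fubini_tonelli_F (fun p => g (cV_cons p))) => //.
  exact: (measurableT_comp mg (@measurable_cV_cons R n)).
- by move=> x; exact: integral_ge0.
Qed.

(** With [v] frozen, the first coordinate undergoes an affine map: its offset [u v] disappears on
    integration and its slope leaves the factor [|a|^-1]. The scaling of [S] then handles [v]. *)
Lemma scales_lebesgue_upper n (F : 'cV[R]_n.+1 -> 'cV[R]_n.+1) (a : R)
    (u : 'cV[R]_n -> R) (S : 'cV[R]_n -> 'cV[R]_n) :
  a != 0%R -> measurable_fun setT F -> scales_lebesgue S ->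
  (forall x v, F (cV_cons (x, v)) = cV_cons (a * x + u v, S v)%R) ->
  scales_lebesgue F.
Proof.
move=> a0 mF [mS [c c0 Sc]] FE; split=> //.
exists (`|a|^-1 * c)%R; first by rewrite mulr_gt0// invr_gt0 normr_gt0.
move=> g mg g0; rewrite (integral_lebesgue_cVS_swap mg g0).
rewrite (integral_lebesgue_cVS_swap (measurableT_comp mg mF) (fun z => g0 _)).
pose h v := \int[lebesgue_measure]_x g (cV_cons (x, v)).
have mh : measurable_fun setT h.
  apply: (measurable_fun_fubini_tonelli_G (fun p => g (cV_cons p))) => //.
  exact: (measurableT_comp mg (@measurable_cV_cons R n)).
transitivity (\int[lebesgue_cV n]_v ((`|a|^-1)%:E * h (S v))).
  apply: eq_integral => v _; 
    rewrite -[RHS](@ge0_integral_affine a (u v) (fun x => g (cV_cons (x, S v))))//.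
    by apply: eq_integral => x _; rewrite /= FE.
  by apply: (measurableT_comp mg); exact: measurable_cV_consv.
have h0 v : 0 <= h v by exact: integral_ge0.
rewrite (ge0_integralTZl _ (measurableT_comp mh mS) (fun v => h0 _)); last first.
  by rewrite lee_fin invr_ge0.
by rewrite [X in _ * X](Sc h mh h0) EFinM muleA.
Qed.

(** With [x] frozen, this is a translation of the remaining coordinates, so the scaling constant is
    1. *)
Lemma scales_lebesgue_lower n (F : 'cV[R]_n.+1 -> 'cV[R]_n.+1)
    (w : R -> 'cV[R]_n) :
  measurable_fun setT F ->
  (forall x v, F (cV_cons (x, v)) = cV_cons (x, v + w x)%R) ->
  scales_lebesgue F.
Proof.
move=> mF FE; split=> //; exists 1%R => // g mg g0; rewrite mul1e.
rewrite (integral_lebesgue_cVS mg g0).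
rewrite (integral_lebesgue_cVS (measurableT_comp mg mF) (fun z => g0 _)).
apply: eq_integral => x _; rewrite -[RHS](integral_lebesgue_cV_translation (w x))//.
  by apply: eq_integral => v _; rewrite /= FE.
by apply: (measurableT_comp mg); exact: measurable_cV_consx.
Qed.

Lemma scales_lebesgue_id n : scales_lebesgue (@id 'cV[R]_n).
Proof. by split=> //; exists 1%R => // g mg g0; rewrite mul1e. Qed.

Lemma mulmx_cons n (A : 'M[R]_n.+1) (x : R) (v : 'cV[R]_n) :
  A *m cV_cons (x, v) = cV_cons
    (A ord0 ord0 * x + \sum_j A ord0 (lift ord0 j) * v j ord0,
     (\matrix_(i, j) A (lift ord0 i) (lift ord0 j)) *m v +
       x *: (\col_i A (lift ord0 i) ord0))%R.
Proof.
apply/colP => i; rewrite mxE big_ord_recl cV_consE0.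
under eq_bigr do rewrite cV_consES.
have [j|] := unliftP ord0 i => ->; last by rewrite cV_consE0.
rewrite cV_consES !mxE /= addrC mulrC; congr (_ + _)%R.
by apply: eq_bigr => k _; rewrite mxE.
Qed.

Lemma measurable_cV_uncons_fun n (F : 'cV[R]_n.+1 -> 'cV[R]_n.+1) p q :
  measurable_fun setT p -> measurable_fun setT q ->
  (forall x v, F (cV_cons (x, v)) = cV_cons (p (x, v), q (x, v))) ->
  measurable_fun setT F.
Proof.
move=> mp mq FE.
have -> : F = @cV_cons R n \o (fun z => (p z, q z)) \o @cV_uncons R n.
  by apply/funext => z; rewrite /= -[in LHS](cV_unconsK z) FE.
apply: measurableT_comp; last exact: measurable_cV_uncons.
apply: measurableT_comp; first exact: measurable_cV_cons.
exact: measurable_fun_pair.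
Qed.

(** One step of Gaussian elimination: with a nonzero pivot [B 0 0], the map [B]
    is a lower shear composed with a map that is block triangular, the block
    being the Schur complement; a vanishing pivot is repaired by adding a row to
    the first one. *)
Lemma scales_lebesgue_mulmx n (A : 'M[R]_n) :
  (forall v : 'cV[R]_n, A *m v = 0%R -> v = 0%R) ->
  scales_lebesgue (mulmx A : 'cV[R]_n -> 'cV[R]_n).
Proof.
elim: n A => [|n IHn] A kerA.
  rewrite (_ : mulmx A = id); first exact: scales_lebesgue_id.
  by apply/funext => v; apply/colP => -[].
have pivot (B : 'M[R]_n.+1) : B ord0 ord0 != 0%R ->
    (forall v : 'cV[R]_n.+1, B *m v = 0%R -> v = 0%R) ->
    scales_lebesgue (mulmx B : 'cV[R]_n.+1 -> 'cV[R]_n.+1).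
  move=> a0 kerB; set a := B ord0 ord0 in a0.
  pose u (v : 'cV[R]_n) := (\sum_j B ord0 (lift ord0 j) * v j ord0)%R.
  pose U : 'rV[R]_n := \row_j B ord0 (lift ord0 j).
  pose S : 'M[R]_n := (\matrix_(i, j) B (lift ord0 i) (lift ord0 j)).
  pose b : 'cV[R]_n := (\col_i B (lift ord0 i) ord0).
  pose S' : 'M[R]_n := (S - a^-1 *: (b *m U))%R.
  have BE x (v : 'cV[R]_n) : B *m cV_cons (x, v) = cV_cons (a * x + u v, S *m v + x *: b)%R.
    exact: mulmx_cons.
  have S'E (v : 'cV[R]_n) : (S' *m v = S *m v - (a^-1 * u v) *: b)%R.
    rewrite mulmxBl -scalemxAl -mulmxA [U *m v]mx11_scalar mul_mx_scalar.
    rewrite scalerA; congr (_ - (_ * _) *: _)%R.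
    by rewrite mxE; apply: eq_bigr => j _; rewrite mxE.
  (* A kernel vector [v] of the Schur complement extends to a kernel vector of [B]: the first
     coordinate [- (a^-1 * u v)] solves the first row. *)
  have kerS' (v : 'cV[R]_n) : S' *m v = 0%R -> v = 0%R.
    move=> S'v0; have /kerB : B *m cV_cons (- (a^-1 * u v), v)%R = 0%R.
      rewrite BE mulrN mulrA divff// mul1r addNr scaleNr -S'E S'v0.
      by apply/colP => i; rewrite mxE; case: unlift => [j|]//=; rewrite !mxE.
    move=> cons0; apply/colP => j.
    by rewrite -(cV_consES (- (a^-1 * u v), v)%R) cons0 !mxE.
  pose F1 (z : 'cV[R]_n.+1) : 'cV[R]_n.+1 :=
    cV_cons (a * z ord0 ord0 + u (cV_uncons z).2, S' *m (cV_uncons z).2)%R.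
  pose F2 (z : 'cV[R]_n.+1) : 'cV[R]_n.+1 :=
    cV_cons (z ord0 ord0, (cV_uncons z).2 + (a^-1 * z ord0 ord0) *: b)%R.
  have F1E x v : F1 (cV_cons (x, v)) = cV_cons (a * x + u v, S' *m v)%R.
    by rewrite /F1 cV_consK cV_consE0.
  have F2E x v : F2 (cV_cons (x, v)) = cV_cons (x, v + (a^-1 * x) *: b)%R.
    by rewrite /F2 cV_consK cV_consE0.
  have mu : measurable_fun setT u.
    apply: measurable_sum => j; apply: measurable_funM => //.
    exact: measurable_coord.
  have -> : mulmx B = F2 \o F1.
    apply/funext => z; rewrite -[z]cV_unconsK; case: (cV_uncons z) => x v.
    rewrite /= F1E F2E BE S'E mulrDr mulrA mulVf// mul1r scalerDl.
    by rewrite [(x *: b + _)%R]addrC addrA subrK.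
  apply: scales_lebesgue_comp.
    apply: (scales_lebesgue_lower (w := fun x => (a^-1 * x) *: b)) => //.
    apply: (measurable_cV_uncons_fun (p := fst)
      (q := fun z => z.2 + (a^-1 * z.1) *: b)%R) => //.
    apply: measurable_addmx; first exact: measurable_snd.
    apply: measurable_fun_cV => i; under eq_fun do rewrite mxE.
    by apply: measurable_funM => //; apply: measurable_funM.
  apply: (scales_lebesgue_upper (u := u) a0 _ (IHn S' kerS')) => //.
  apply: (measurable_cV_uncons_fun (p := fun z => (a * z.1 + u z.2)%R)
    (q := fun z => S' *m z.2)) => //.
    apply: measurable_funD; last exact: (measurableT_comp mu measurable_snd).
    by apply: measurable_funM => //; exact: measurable_fst.
  exact: (measurableT_comp (measurable_mulmxl S') measurable_snd).
have [A00|A00] := eqVneq (A ord0 ord0) 0%R; last exact: pivot.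
(* A zero first column would put the first basis vector in the kernel. *)
have [j Aj] : exists j : 'I_n, A (lift ord0 j) ord0 != 0%R.
  apply/not_existsP => Aj.
  have /kerA /colP /(_ ord0) : A *m cV_cons (1, 0)%R = 0%R.
    rewrite mulmx_cons A00 mul0r add0r mulmx0 scale1r add0r.
    rewrite big1 => [|j _]; last by rewrite mxE mulr0.
    apply/colP => i; rewrite !mxE; case: unlift => [j|]//=.
    by rewrite !mxE; apply/eqP/negPn/negP; exact: Aj.
  by rewrite cV_consE0 mxE => /eqP; rewrite oner_eq0.
pose B := (\matrix_(i, k) (A i k + (i == ord0)%:R * A (lift ord0 j) k))%R : 'M[R]_n.+1.
have BE (z : 'cV[R]_n.+1) i :
    (B *m z) i ord0 = ((A *m z) i ord0 + (i == ord0)%:R * (A *m z) (lift ord0 j) ord0)%R.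
  rewrite !mxE mulr_sumr -big_split; apply: eq_bigr => k _.
  by rewrite mxE mulrDl mulrA.
have kn0 (k : 'I_n) : (lift ord0 k == ord0) = false by [].
have scB : scales_lebesgue (mulmx B : 'cV[R]_n.+1 -> 'cV[R]_n.+1).
  apply: pivot; first by rewrite mxE A00 add0r eqxx mul1r.
  move=> z /colP Bz0; apply: kerA; apply/colP => i; rewrite [RHS]mxE.
  have Azl k : (A *m z) (lift ord0 k) ord0 = 0%R.
    by have := Bz0 (lift ord0 k); rewrite BE kn0 mul0r addr0 => ->; rewrite mxE.
  have [k|] := unliftP ord0 i => ->; first exact: Azl.
  by have := Bz0 ord0; rewrite BE Azl mulr0 addr0 => ->; rewrite mxE.
(* This undoes the row operation that produced [B]. It is block triangular itself, with slope 1 and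
   the identity as lower block. *)
pose F (z : 'cV[R]_n.+1) : 'cV[R]_n.+1 :=
  cV_cons (1 * z ord0 ord0 + - (cV_uncons z).2 j ord0, (cV_uncons z).2)%R.
have FE x v : F (cV_cons (x, v)) = cV_cons (1 * x + - v j ord0, v)%R.
  by rewrite /F cV_consK cV_consE0.
have -> : mulmx A = F \o mulmx B.
  apply/funext => z; apply/colP => i; rewrite /= /F.
  have [k|] := unliftP ord0 i => ->.
    by rewrite cV_consES [RHS]mxE BE kn0 mul0r addr0.
  rewrite cV_consE0 /= [X in (_ - X)%R]mxE !BE eqxx kn0 mul0r addr0 !mul1r.
  by rewrite addrK.
apply: scales_lebesgue_comp => //.
apply: (@scales_lebesgue_upper n F 1%R (fun v => - v j ord0)%R id _ _ _ FE).
- exact: oner_neq0.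
- apply: (measurable_cV_uncons_fun (p := fun z => (1 * z.1 + - z.2 j ord0)%R)
    (q := snd)); last exact: FE.
    apply: measurable_funD; first by apply: measurable_funM.
    apply: measurableT_comp => //.
    exact: (measurableT_comp (measurable_coord j) measurable_snd).
  exact: measurable_snd.
- exact: scales_lebesgue_id.
Qed.

End linear_change_of_variables.

(** * Rotation invariance of the Gaussian measure *)

Section gauss_rotation.
Context {R : realType}.
Local Open Scope ereal_scope.

(** The product of one-dimensional densities depends on [z] only through [z^T z]. *)
Lemma phi0_orthonormal n (A : 'M[R]_n) (z : 'cV[R]_n) :
  orthonormal_cols A -> phi0 (A *m z) = phi0 z.
Proof.
move=> AA; have phiE (v : 'cV[R]_n) : phi0 v =
    (normal_peak 1 ^+ n * expR (- (v^T *m v) ord0 ord0 / 2))%R.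
  rewrite /phi0 mxE -sumrN mulr_suml expR_sum -[X in (_ ^+ X)%R]card_ord -prodr_const.
  rewrite -big_split; apply: eq_bigr => i _ /=.
  by rewrite normal_pdfE ?oner_neq0// /normal_fun subr0 expr1n mxE expr2.
by rewrite !phiE trmx_mul -mulmxA (mulmxA A^T) AA mul1mx.
Qed.

Lemma integral_gauss_orthonormal n (A : 'M[R]_n) (g : 'cV[R]_n -> \bar R) :
  orthonormal_cols A -> measurable_fun setT g -> (forall z, 0 <= g z) ->
  \int[gauss n]_z g (A *m z) = \int[gauss n]_z g z.
Proof.
move=> AA.
have kerA (v : 'cV[R]_n) : A *m v = 0%R -> v = 0%R.
  by move=> Av0; rewrite -[v]mul1mx -AA -mulmxA Av0 mulmx0.
have [mA [c c0 Ac]] := scales_lebesgue_mulmx kerA.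
have AcE (h : 'cV[R]_n -> \bar R) : measurable_fun setT h -> (forall z, 0 <= h z) ->
    \int[gauss n]_z h (A *m z) = c%:E * \int[gauss n]_z h z.
  move=> mh h0.
  rewrite (integral_gauss mh h0).
  rewrite (integral_gauss (measurableT_comp mh mA) (fun z => h0 _)) -Ac.
  - by apply: eq_integral => z _; rewrite phi0_orthonormal.
  - apply: emeasurable_funM => //.
    by apply/measurable_EFinP; exact: measurable_phi0.
  - by move=> z; rewrite mule_ge0// lee_fin ltW// phi0_gt0.
move=> mg g0; rewrite AcE// (_ : c%:E = 1) ?mul1e//.
have := AcE (cst 1) (measurable_cst _) (fun=> lee01).
by rewrite !(integral_probability_cst (gauss n) 1) mule1.
Qed.

(** The square matrix [row_mx U V] has orthonormal columns, so rotation invariance reduces the claim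
    to the coordinate splitting. The dimension is tied by an equation, not by the type, because the
    use has [k = d - r]. *)
Lemma integral_gauss_frame d r k (U : 'M[R]_(d, r)) (V : 'M[R]_(d, k))
    (g : 'cV[R]_d -> \bar R) : d = (r + k)%N ->
  orthonormal_cols U -> orthonormal_cols V -> U^T *m V = 0%R ->
  measurable_fun setT g -> (forall z, 0 <= g z) ->
  \int[gauss d]_z g z =
  \int[gauss r]_a \int[gauss k]_b g (U *m a + V *m b)%R.
Proof.
move=> drk UU VV UV mg g0; subst d.
have WW : orthonormal_cols (row_mx U V).
  rewrite /orthonormal_cols tr_row_mx mul_col_row UU VV UV.
  by rewrite -[V^T *m U]trmxK trmx_mul trmxK UV trmx0 -scalar_mx_block.
rewrite -(integral_gauss_orthonormal WW mg g0).
rewrite (integral_gauss_split (measurableT_comp mg (measurable_mulmxl _)) (fun z => g0 _)).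
by apply: eq_integral => a _; apply: eq_integral => b _; rewrite /= mul_row_col.
Qed.

End gauss_rotation.

(** * The Gaussian Poincare inequality in dimension one *)

Section poincare1.
Context {R : realType}.
Local Notation mu := (@lebesgue_measure R).
Local Notation phi := (@normal_pdf R 0 1).

Lemma normal_pdf01E x : phi x = normal_peak 1 * expR (- x ^+ 2 / 2).
Proof. by rewrite normal_pdfE ?oner_neq0// /normal_fun subr0 expr1n. Qed.

Lemma normal_pdf01N x : phi (- x) = phi x.
Proof. by rewrite !normal_pdf01E sqrrN. Qed.

Lemma is_derive_normal_pdf01 (x : R) : is_derive x 1 phi (- x * phi x).
Proof.
rewrite normal_pdf01E; have -> : phi = fun x => normal_peak 1 * expR (- x ^+ 2 / 2).
  by apply/funext => z; exact: normal_pdf01E.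
apply: is_derive_eq; by rewrite /GRing.scale/=; field.
Qed.

Lemma is_derive_continuous (h h' : R -> R) :
  (forall x : R, is_derive x 1 h (h' x)) -> continuous h.
Proof.
move=> dh x; apply: differentiable_continuous; apply/derivable1_diffP.
by case: (dh x).
Qed.

Variables h h' : R -> R.
Hypotheses (dh : forall x : R, is_derive x 1 h (h' x)) (ch' : continuous h').

Let ch : continuous h.
Proof. exact: is_derive_continuous dh. Qed.

(** This is the function whose derivative is subtracted in the Hardy bound. The quotient is singular
    at 0, so the bound is integrated over [[a, b]] with [0 < a], and [a] tends to 0 afterwards. *)
Let k (x : R) := h x ^+ 2 * phi x / x.
Let k' (x : R) := 2 * h x * h' x * phi x / x - h x ^+ 2 * phi x - h x ^+ 2 * phi x / x ^+ 2.

Let dk (x : R) : x != 0 -> is_derive x 1 k (k' x).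
Proof.
move=> x0; have := dh x; have := is_derive_normal_pdf01 x => ? ?.
have dV : is_derive x 1 (fun x : R => x^-1) (- x ^- 2 *: 1) by exact: is_deriveV.
apply: is_derive_eq. rewrite /GRing.scale/= /k'. by field.
Qed.

(** The left side originates in the weight: as [phi' = - x phi], differentiating [phi] in [k]
    cancels the [1/x] and leaves [- h^2 phi] in [k']. *)
Let hardy_pointwise x : x != 0 -> h x ^+ 2 * phi x <= h' x ^+ 2 * phi x - k' x.
Proof.
move=> x0; rewrite -subr_ge0 /k'.
rewrite (_ : _ - _ = (h' x - h x / x) ^+ 2 * phi x); last by field.
by rewrite mulr_ge0 ?sqr_ge0// normal_pdf_ge0.
Qed.

Let cphi : continuous phi.
Proof. by apply: continuous_normal_pdf; rewrite oner_neq0. Qed.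

Let cdens (u : R -> R) : continuous u -> continuous (fun x => u x ^+ 2 * phi x).
Proof.
move=> cu x; apply: cvgM; last exact: cphi.
by rewrite expr2; apply: cvgM; exact: cu.
Qed.

Let ck' (a b : R) : 0 < a -> {within `[a, b], continuous k'}.
Proof.
move=> a0; apply: continuous_in_subspaceT => x /set_mem /=; rewrite in_itv/= => /andP[ax _].
have x0 : x != 0 by rewrite gt_eqF// (lt_le_trans a0).
have cV : {for x, continuous (fun x : R => x^-1)} by exact: inv_continuous.
apply: cvgB.
  apply: cvgB; last exact: (cdens ch).
  apply: cvgM; last exact: cV.
  apply: cvgM; last exact: cphi.
  apply: cvgM; last exact: ch'.
  by apply: cvgM; [exact: cvg_cst|exact: ch].
apply: cvgM; first exact: (cdens ch).
by apply: cvgV; [rewrite expf_neq0|exact: sqr_continuous].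
Qed.

Let hardy_segment (a b : R) : 0 < a -> a < b ->
  (\int[mu]_(x in `[a, b]) (h x ^+ 2 * phi x)%:E <=
   \int[mu]_(x in `[a, b]) (h' x ^+ 2 * phi x)%:E + (k a)%:E)%E.
Proof.
move=> a0 ab.
have x_neq0 x : x \in `[a, b] -> x != 0.
  by rewrite in_itv/= => /andP[ax _]; rewrite gt_eqF// (lt_le_trans a0).
have ftc : (\int[mu]_(x in `[a, b]) (k' x)%:E = (k b)%:E - (k a)%:E)%E.
  have ck x : x != 0 -> {for x, continuous k}.
    move=> x0; apply: differentiable_continuous; apply/derivable1_diffP.
    by case: (dk x0).
  apply: continuous_FTC2 => //; first exact: ck'.
  - split.
    + move=> x xab; have /dk[]// : x != 0.
      by apply: x_neq0; apply: subset_itv_oo_cc.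
    + by apply: cvg_at_right_filter; apply: ck; rewrite gt_eqF.
    + by apply: cvg_at_left_filter; apply: ck; rewrite gt_eqF// (lt_trans a0).
  - move=> x xab; rewrite derive1E; have /dk ? : x != 0.
      by apply: x_neq0; apply: subset_itv_oo_cc.
    exact: derive_val.
have int_cont (u : R -> R) : {within `[a, b], continuous u} ->
    mu.-integrable `[a, b] (EFin \o u).
  by move=> cu; apply: continuous_compact_integrable => //; exact: segment_compact.
have ih : mu.-integrable `[a, b] (EFin \o (fun x => h x ^+ 2 * phi x)).
  by apply: int_cont; apply: continuous_subspaceT; exact: cdens.
have ih' : mu.-integrable `[a, b] (EFin \o (fun x => h' x ^+ 2 * phi x)).
  by apply: int_cont; apply: continuous_subspaceT; exact: cdens.
have ik' : mu.-integrable `[a, b] (EFin \o k') by apply: int_cont; exact: ck'.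
apply: (@le_trans _ _ (\int[mu]_(x in `[a, b])
    ((EFin \o (fun x => (h' x ^+ 2 * phi x)%R)) x - (EFin \o k') x))%E).
  apply: le_integral => //; first exact: integrableB.
  by move=> x /set_mem xab; rewrite /= lee_fin; apply/hardy_pointwise/x_neq0.
rewrite integralB// ftc leeD2l// -EFinB -EFinN lee_fin opprB gerDl oppr_le0.
apply: divr_ge0; last exact: (le_trans (ltW a0) (ltW ab)).
by rewrite mulr_ge0 ?sqr_ge0 ?normal_pdf_ge0.
Qed.

(** Vanishing of [h] at 0 makes [h x / x] tend to [h' 0], and [k x] is [(h x / x)^2 phi x] times
    [x]. *)
Let k_cvg0 : h 0 = 0 -> k (n.+1%:R^-1) @[n --> \oo] --> 0.
Proof.
move=> h0; pose dn (n : nat) : R := n.+1%:R^-1.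
have dn0 : dn n @[n --> \oo] --> 0 by exact: cvg_harmonic.
have quot : (dn n)^-1 * h (dn n) @[n --> \oo] --> h' 0.
  have [+ <-] := dh 0; rewrite /derivable /derive.
  under eq_fun do rewrite /= addr0 h0 subr0 /GRing.scale/= mulr1.
  move=> cv; apply: ((cvg_at_rightP (fun x => x^-1 * h x) 0 _).1
    (cvg_dnbhs_at_right cv)).
  by split=> // n; rewrite invr_gt0.
have -> : (fun n => k n.+1%:R^-1) =
    (fun n => ((dn n)^-1 * h (dn n)) ^+ 2 * phi (dn n) * dn n).
  apply/funext => n; rewrite /k -/(dn n); have : dn n != 0 by rewrite invr_neq0.
  by move=> ?; field.
rewrite -[X in _ --> X](mulr0 (h' 0 ^+ 2 * phi 0)).
apply: cvgM => //; apply: cvgM; last by apply: continuous_cvg => //; exact: cphi.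
by rewrite expr2; under eq_fun do rewrite expr2; exact: cvgM.
Qed.

Lemma gauss_hardy_half_line : h 0 = 0 ->
  (\int[mu]_(x in `[0%R, +oo[) (h x ^+ 2 * phi x)%:E <=
   \int[mu]_(x in `[0%R, +oo[) (h' x ^+ 2 * phi x)%:E)%E.
Proof.
move=> h0; pose dn (n : nat) : R := n.+1%:R^-1.
(* The upper end is [n + 2] so that already for [n = 0] it exceeds the lower end, which is then
   1. *)
pose F (n : nat) : set R := [set` `[dn n, n.+2%:R]].
have dn_gt0 n : 0 < dn n by rewrite invr_gt0.
have FU : \bigcup_n F n = `]0%R, +oo[%classic.
  apply/seteqP; split => x /=.
    move=> [n _] /=; rewrite !in_itv/= andbT => /andP[nx _].
    exact: (lt_le_trans (dn_gt0 n) nx).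
  rewrite in_itv/= andbT => x0.
  exists (maxn (Num.trunc x^-1) (Num.trunc x)) => //.
  rewrite /F/= in_itv/=; apply/andP; split.
    rewrite /dn -[leRHS]invrK lef_pV2 ?posrE ?invr_gt0//.
    rewrite (le_trans (ltW (truncnS_gt _)))// ler_nat ltnS leq_maxl//.
  by rewrite (le_trans (ltW (truncnS_gt _)))// ler_nat ltnS leqW// leq_maxr.
have ndF : nondecreasing_seq F.
  move=> n m nm; rewrite subsetEset => x; rewrite /F/= !in_itv/= => /andP[nx xn].
  apply/andP; split; last by rewrite (le_trans xn)// ler_nat !ltnS.
  by rewrite (le_trans _ nx)// lef_pV2 ?posrE// ler_nat ltnS.
have mdens (u : R -> R) A : measurable A -> continuous u ->
    measurable_fun A (fun x => (u x ^+ 2 * phi x)%:E).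
  move=> mA cu; apply: measurable_funTS; apply/measurable_EFinP.
  by apply: continuous_measurable_fun; exact: cdens.
have dens0 (u : R -> R) (x : R) : (0 <= (u x ^+ 2 * phi x)%:E)%E.
  by rewrite lee_fin mulr_ge0 ?sqr_ge0 ?normal_pdf_ge0.
have mF n : measurable (F n) by exact: measurable_itv.
(* The endpoint 0 is a null set; without it, the half-line is the increasing union of the segments
   [F n]. *)
rewrite -!integral_itv_obnd_cbnd; last 2 first.
- by apply: mdens; [exact: measurable_itv|exact: ch'].
- by apply: mdens; [exact: measurable_itv|exact: ch].
have cvgF : (\int[mu]_(x in F n) (h x ^+ 2 * phi x)%:E @[n --> \oo] -->
    \int[mu]_(x in `]0%R, +oo[) (h x ^+ 2 * phi x)%:E)%E.
  rewrite -FU; apply: ge0_nondecreasing_set_cvg_integral => //.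
  by move=> n; apply: mdens; [exact: mF|exact: ch].
apply/lee_addgt0Pr => e e0.
(* The slack [e] absorbs the boundary term [k (dn n)], which is eventually smaller. *)
rewrite -(cvg_lim _ cvgF)//; apply: lime_le; first by apply: cvgP cvgF.
have /cvgrPdist_lt /(_ e e0) := k_cvg0 h0.
apply: filterS => n; rewrite sub0r normrN => /ltr_normlW kn.
apply: (@le_trans _ _ (\int[mu]_(x in F n) (h' x ^+ 2 * phi x)%:E + (k (dn n))%:E)%E).
  apply: hardy_segment => //.
  rewrite (@le_lt_trans _ _ 1)// ?ltr1n// invf_le1// ler1n//.
apply: leeD; last by rewrite lee_fin ltW.
apply: ge0_subset_integral => //; first exact: mF.
  by apply: mdens; [exact: measurable_itv|exact: ch'].
by rewrite -FU; exact: bigcup_sup.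
Qed.

End poincare1.

(** * Hardy and Poincare inequalities for the Gaussian law on the whole line *)

Section poincare_dim1.
Context {R : realType}.
Local Open Scope ereal_scope.
Local Notation mu := (@lebesgue_measure R).
Local Notation phi := (@normal_pdf R 0 1).

Lemma ge0_integral_fold (g : R -> \bar R) :
  measurable_fun setT g -> (forall x, 0 <= g x) ->
  \int[mu]_x g x = \int[mu]_(x in `[0%R, +oo[) g x +
                   \int[mu]_(x in `[0%R, +oo[) g (- x)%R.
Proof.
move=> mg g0; have mgN : measurable_fun setT (fun x : R => g (- x)%R).
  exact: (measurableT_comp mg).
rewrite (ge0_integration_by_substitution0 mgN (fun x => g0 _)).
under [X in _ + X]eq_integral do rewrite opprK.
rewrite -integral_itv_bndo_bndc; last exact: measurable_funTS.
rewrite addeC -ge0_integral_setU//=.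
- congr (integral _ _ _); apply/seteqP; split => // x _.
  by rewrite /= !in_itv/= andbT; have [|] := ltP x 0%R; [left|right].
- exact: measurable_funTS.
- apply/disj_setPS => x []; rewrite /= !in_itv/= andbT => x0 /(lt_le_trans x0).
  by rewrite ltxx.
Qed.

Lemma gauss_hardy (h h' : R -> R) : (forall x : R, is_derive x 1%R h (h' x)) ->
  continuous h' -> h 0%R = 0%R ->
  \int[normal_prob 0%R 1%R]_x (h x ^+ 2)%:E <=
  \int[normal_prob 0%R 1%R]_x (h' x ^+ 2)%:E.
Proof.
move=> dh ch' h0.
have ch : continuous h by exact: is_derive_continuous dh.
have msq (u : R -> R) : continuous u -> measurable_fun setT (fun x => (u x ^+ 2)%:E).
  move=> cu; apply/measurable_EFinP; apply: measurable_funX.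
  exact: continuous_measurable_fun.
have sq0 (u : R -> R) x : 0 <= (u x ^+ 2)%:E by rewrite lee_fin sqr_ge0.
have mphi : measurable_fun setT (fun x => (phi x)%:E).
  by apply/measurable_EFinP; exact: measurable_normal_pdf.
rewrite !integral_normal//; [|exact: msq..].
rewrite !ge0_integral_fold; last 4 first.
- by apply: emeasurable_funM => //; exact: msq.
- by move=> x; rewrite mule_ge0// lee_fin normal_pdf_ge0.
- by apply: emeasurable_funM => //; exact: msq.
- by move=> x; rewrite mule_ge0// lee_fin normal_pdf_ge0.
apply: leeD.
  exact: (gauss_hardy_half_line dh ch' h0).
under eq_integral do rewrite normal_pdf01N.
under [leRHS]eq_integral do rewrite normal_pdf01N.
(* The negative half-line is the positive one for the reflected function; the sign of its derivative
   is lost in the square. *)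
pose hN (x : R) := h (- x)%R; pose hN' (x : R) := (- h' (- x))%R.
have dhN (x : R) : is_derive x 1%R hN (hN' x).
  have := dh (- x)%R => ?; rewrite /hN.
  have dN : is_derive x (1 : R)%R (fun y : R => - y)%R (-1)%R by apply: is_derive_eq.
  have := is_derive1_comp (dh (- x)%R) dN.
  by rewrite /hN' mulrN1.
have chN' : continuous hN'.
  move=> x; apply: cvgN; apply: continuous_comp; last exact: ch'.
  exact: opp_continuous.
have := gauss_hardy_half_line dhN chN'; rewrite /hN oppr0 => /(_ h0).
by under [leRHS]eq_integral do rewrite /hN' sqrrN.
Qed.

(** With [c = h 0] and mean [M], expanding gives [E h^2 + c^2 = E (h - c)^2 + 2 c M]. Hardy bounds
    the first term on the right, and [(M - c)^2 >= 0] turns [2 c M] into [M^2 + c^2]. *)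
Lemma gauss_poincare1 (h h' : R -> R) : (forall x : R, is_derive x 1%R h (h' x)) ->
  continuous h' -> (forall x, (0 <= h x)%R) ->
  \int[normal_prob 0%R 1%R]_x (h x ^+ 2)%:E <=
  (\int[normal_prob 0%R 1%R]_x (h x)%:E) ^+ 2 +
  \int[normal_prob 0%R 1%R]_x (h' x ^+ 2)%:E.
Proof.
move=> dh ch' h_ge0.
have ch : continuous h by exact: is_derive_continuous dh.
pose P : probability _ R := normal_prob 0%R 1%R.
set M := (X in X ^+ 2 + _).
have mh : measurable_fun setT h by exact: continuous_measurable_fun.
have M0 : 0 <= M by apply: integral_ge0 => x _; rewrite lee_fin.
(* With an infinite mean the right-hand side is infinite; otherwise [M] is a real number and the
   algebra takes place in [R]. *)
have [Moo|] := ltP M +oo; last first.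
  rewrite leye_eq => /eqP ->; rewrite expe2 mulyy addye ?leey//.
  by rewrite gt_eqF// (lt_le_trans _ (integral_ge0 _ _))// => x _; rewrite lee_fin sqr_ge0.
pose c := h 0%R; pose hc (x : R) := (h x - c)%R.
have dhc (x : R) : is_derive x 1%R hc (h' x).
  have := dh x => ?; rewrite -[h' x]subr0; exact: is_deriveB.
have := gauss_hardy dhc ch'; rewrite /hc subrr => /(_ erefl) hardy.
have c0 : (0 <= c)%R by exact: h_ge0.
have mE (u : R -> R) : measurable_fun setT u -> measurable_fun setT (fun x => (u x)%:E).
  by move=> mu'; apply/measurable_EFinP.
have mhc : measurable_fun setT (fun x => (h x - c) ^+ 2)%R.
  by apply: measurable_funX; exact: measurable_funB.
have : \int[P]_x (h x ^+ 2)%:E + (c ^+ 2)%:E =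
       \int[P]_x ((h x - c) ^+ 2)%:E + (2 * c)%:E * M.
  rewrite -ge0_integralTZl; [|exact: mE|by []|by rewrite lee_fin mulr_ge0].
  rewrite -[X in _ + X = _](integral_probability_cst P) -!ge0_integralTD.
  - by apply: eq_integral => x _; rewrite -EFinM -!EFinD; congr (_%:E); ring.
  - exact: mE.
  - by move=> x; rewrite lee_fin sqr_ge0.
  - by apply/measurable_EFinP; exact: measurable_funM.
  - by move=> x; rewrite -EFinM lee_fin !mulr_ge0.
  - by apply: mE; exact: measurable_funX.
  - by move=> x; rewrite lee_fin sqr_ge0.
  - exact: measurable_cst.
  - by move=> x; rewrite lee_fin sqr_ge0.
move=> eqc; rewrite -(@leeD2rE _ (c ^+ 2)%:E)// eqc.
have Mfin : M \is a fin_num by rewrite ge0_fin_numE.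
rewrite [leRHS]addeAC [leRHS]addeC; apply: (leeD hardy).
rewrite -(fineK Mfin) expe2 -!EFinM -EFinD lee_fin.
by have := sqr_ge0 (fine M - c)%R; rewrite -subr_ge0; lra.
Qed.

End poincare_dim1.

(** * Tensorization *)

Section efron_stein.
Local Open Scope ereal_scope.
Context {R : realType}.

Let measurable_sq d (T : measurableType d) (f : T -> \bar R) :
  measurable_fun setT f -> measurable_fun setT (fun x => f x ^+ 2).
Proof. by move=> mf; under eq_fun do rewrite expe2; exact: emeasurable_funM. Qed.

Lemma expe2_ge0 (x : \bar R) : 0 <= x -> 0 <= x ^+ 2.
Proof. by move=> x0; rewrite expe2 mule_ge0. Qed.

(** On a probability space [u <= 1 + u^2] suffices. *)
Lemma integral_lty_sqr d (T : measurableType d) (P : probability T R)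
    (u : T -> R) : measurable_fun setT u -> (forall x, (0 <= u x)%R) ->
  \int[P]_x (u x ^+ 2)%:E < +oo -> \int[P]_x (u x)%:E < +oo.
Proof.
move=> mu u0 u2; apply: (@le_lt_trans _ _ (\int[P]_x (1 + (u x ^+ 2)%:E))).
  apply: ge0_le_integralT.
  - exact/measurable_EFinP.
  - by move=> x; rewrite lee_fin.
  - by apply: emeasurable_funD => //; apply/measurable_EFinP; exact: measurable_funX.
  - by move=> x; rewrite -EFinD lee_fin; nra.
rewrite ge0_integralTD.
- by rewrite integral_probability_cst lte_add_pinfty// ltry.
- exact: measurable_cst.
- by move=> x; exact: lee01.
- by apply/measurable_EFinP; exact: measurable_funX.
- by move=> x; rewrite lee_fin sqr_ge0.
Qed.

(** Integrate [2 t u <= u^2 + t^2] with [t] the mean of [u]. *)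
Lemma sqr_integral_le d (T : measurableType d) (P : probability T R)
    (u : T -> R) : measurable_fun setT u -> (forall x, (0 <= u x)%R) ->
  (\int[P]_x (u x)%:E) ^+ 2 <= \int[P]_x (u x ^+ 2)%:E.
Proof.
move=> mu u0; have mEu : measurable_fun setT (fun x => (u x)%:E) by exact/measurable_EFinP.
have mEu2 : measurable_fun setT (fun x => (u x ^+ 2)%:E).
  by apply/measurable_EFinP; exact: measurable_funX.
have int0 : 0 <= \int[P]_x (u x)%:E by apply: integral_ge0 => x _; rewrite lee_fin.
have [u2|] := ltP (\int[P]_x (u x ^+ 2)%:E) +oo; last first.
  by rewrite leye_eq => /eqP ->; exact: leey.
have := integral_lty_sqr mu u0 u2.
rewrite -ge0_fin_numE// => ufin; set t := fine (\int[P]_x (u x)%:E).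
have t0 : (0 <= t)%R by exact: fine_ge0.
have tE : \int[P]_x (u x)%:E = t%:E by rewrite fineK.
have : \int[P]_x ((2 * t)%:E * (u x)%:E) <= \int[P]_x ((u x ^+ 2)%:E + (t ^+ 2)%:E).
  apply: ge0_le_integralT.
  - exact: emeasurable_funM.
  - by move=> x; rewrite -EFinM lee_fin !mulr_ge0.
  - exact: emeasurable_funD.
  - move=> x; rewrite -EFinM -EFinD lee_fin.
    by have := sqr_ge0 (u x - t)%R; nra.
have t2_ge0 : 0 <= (2 * t)%:E by rewrite lee_fin mulr_ge0.
have u_ge0 x : 0 <= (u x)%:E by rewrite lee_fin.
have u2_ge0 x : 0 <= (u x ^+ 2)%:E by rewrite lee_fin sqr_ge0.
have tt_ge0 : 0 <= (t ^+ 2)%:E by rewrite lee_fin sqr_ge0.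
rewrite (ge0_integralTZl _ mEu u_ge0 t2_ge0).
rewrite (ge0_integralTD _ mEu2 u2_ge0 (measurable_cst _) (fun=> tt_ge0)).
rewrite integral_probability_cst tE expe2 -!EFinM -leeBlDr// -EFinB.
apply: le_trans; rewrite lee_fin; nra.
Qed.

(** This is [(a + M - (b + c))^2 >= 0] with the negative cross terms moved to the left. The partial
    means [b] and [c] may be infinite at some points, where the right side is infinite too. *)
Lemma cross_terms_le (M a : R) (b c : \bar R) :
  (0 <= M)%R -> (0 <= a)%R -> 0 <= b -> 0 <= c ->
  2%:E * ((b * a%:E + c * a%:E) + M%:E * (b + c)) <=
  ((a ^+ 2)%:E + (b * b + c * c)) + 2%:E * (M%:E * a%:E + b * c) + M%:E * M%:E.
Proof.
move=> M0 a0 b0 c0.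
have nNy (t : \bar R) : 0 <= t -> t != -oo.
  by move=> t0; rewrite gt_eqF// (lt_le_trans ltNy0).
have infty : b = +oo \/ c = +oo ->
    ((a ^+ 2)%:E + (b * b + c * c)) + 2%:E * (M%:E * a%:E + b * c) + M%:E * M%:E = +oo.
  move=> bc; have -> : b * b + c * c = +oo.
    by case: bc => ->; rewrite mulyy ?addye ?addey ?nNy ?mule_ge0.
  have ? : 0 <= 2%:E * (M%:E * a%:E + b * c).
    by rewrite mule_ge0 ?lee_fin// adde_ge0 ?mule_ge0 ?lee_fin.
  by rewrite addey ?nNy ?lee_fin ?sqr_ge0// addye ?nNy// addye.
case: b b0 infty => [b| |]// b0 infty; last by rewrite infty ?leey//; left.
case: c c0 infty => [c| |]// c0 infty; last by rewrite infty ?leey//; right.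
rewrite !(=^~ EFinM, =^~ EFinD) lee_fin.
by have := sqr_ge0 (a + M - (b + c))%R; rewrite -subr_ge0; lra.
Qed.

Context d1 d2 (T1 : measurableType d1) (T2 : measurableType d2).
Variables (P : probability T1 R) (Q : probability T2 R) (h : T1 * T2 -> R).
Hypotheses (mh : measurable_fun setT h) (h0 : forall z, (0 <= h z)%R).

(** With [m2 x] and [m1 v] the partial means and [M] the total mean, this is the
    integral of [(h + M - m2 - m1)^2 >= 0]; [cross_terms_le] writes it without
    subtraction, so that Tonelli applies to every term. *)
Lemma efron_stein : \int[P \x Q]_z (h z ^+ 2)%:E < +oo ->
  \int[P]_x (\int[Q]_v (h (x, v))%:E) ^+ 2 +
  \int[Q]_v (\int[P]_x (h (x, v))%:E) ^+ 2 <=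
  \int[P \x Q]_z (h z ^+ 2)%:E + (\int[P \x Q]_z (h z)%:E) ^+ 2.
Proof.
pose E (f : T1 * T2 -> \bar R) := \int[P \x Q]_z f z.
pose a (z : T1 * T2) := (h z)%:E.
pose m2 x := \int[Q]_v (h (x, v))%:E; pose m1 v := \int[P]_x (h (x, v))%:E.
pose b (z : T1 * T2) := m2 z.1; pose c (z : T1 * T2) := m1 z.2.
have ma : measurable_fun setT a by exact/measurable_EFinP.
have a0 z : 0 <= a z by rewrite lee_fin.
have mm2 : measurable_fun setT m2 by exact: (measurable_fun_fubini_tonelli_F a).
have mm1 : measurable_fun setT m1 by exact: (measurable_fun_fubini_tonelli_G a).
have m2_ge0 x : 0 <= m2 x by apply: integral_ge0 => v _; rewrite lee_fin.
have m1_ge0 x : 0 <= m1 x by apply: integral_ge0 => v _; rewrite lee_fin.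
have mb : measurable_fun setT b by exact: (measurableT_comp mm2 measurable_fst).
have mc : measurable_fun setT c by exact: (measurableT_comp mm1 measurable_snd).
have b0 z : 0 <= b z by exact: m2_ge0.
have c0 z : 0 <= c z by exact: m1_ge0.
have mM (f g : T1 * T2 -> \bar R) : measurable_fun setT f -> measurable_fun setT g ->
  measurable_fun setT (fun z : T1 * T2 => f z * g z) by exact: emeasurable_funM.
have M0 (f g : T1 * T2 -> \bar R) : (forall z, 0 <= f z) -> (forall z, 0 <= g z) ->
  forall z, 0 <= f z * g z by move=> f0 g0 z; exact: mule_ge0.
have mD (f g : T1 * T2 -> \bar R) : measurable_fun setT f -> measurable_fun setT g ->
  measurable_fun setT (fun z : T1 * T2 => f z + g z) by exact: emeasurable_funD.
have D0 (f g : T1 * T2 -> \bar R) : (forall z, 0 <= f z) -> (forall z, 0 <= g z) ->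
  forall z, 0 <= f z + g z by move=> f0 g0 z; exact: adde_ge0.
have mx1 x : measurable_fun setT (fun v => a (x, v)).
  exact: (measurableT_comp ma (pair1_measurable x)).
have mx2 v : measurable_fun setT (fun x => a (x, v)).
  exact: (measurableT_comp ma (pair2_measurable v)).
set A := \int[P]_x _; set B := \int[Q]_v _ ^+ 2; set H := \int[_]_z _.
set M := (X in _ <= H + X ^+ 2) => Hoo.
have Eb : E b = M.
  rewrite /E (fubini_tonelli1 b mb b0) /M (fubini_tonelli1 a ma a0).
  by apply: eq_integral => x _; rewrite /fubini_F /b /= integral_probability_cst.
have Ec : E c = M.
  rewrite /E (fubini_tonelli2 c mc c0) /M (fubini_tonelli2 a ma a0).
  by apply: eq_integral => v _; rewrite /fubini_G /c /= integral_probability_cst.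
(* In each product, Tonelli is used in the order that freezes the variable of a partial mean, which
   then factors out of the inner integral. *)
have Eab : E (fun z => b z * a z) = A.
  rewrite /E (fubini_tonelli1 _ (mM _ _ mb ma) (M0 _ _ b0 a0)).
  by apply: eq_integral => x _; rewrite /fubini_F /b /= ge0_integralTZl.
have Eac : E (fun z => c z * a z) = B.
  rewrite /E (fubini_tonelli2 _ (mM _ _ mc ma) (M0 _ _ c0 a0)).
  by apply: eq_integral => v _; rewrite /fubini_G /c /= ge0_integralTZl.
have Ebb : E (fun z => b z * b z) = A.
  rewrite /E (fubini_tonelli1 _ (mM _ _ mb mb) (M0 _ _ b0 b0)).
  by apply: eq_integral => x _; rewrite /fubini_F /b /= integral_probability_cst -expe2.
have Ecc : E (fun z => c z * c z) = B.
  rewrite /E (fubini_tonelli2 _ (mM _ _ mc mc) (M0 _ _ c0 c0)).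
  by apply: eq_integral => v _; rewrite /fubini_G /c /= integral_probability_cst -expe2.
have M_ge0 : 0 <= M by apply: integral_ge0 => z _; exact: a0.
have Ebc : E (fun z => b z * c z) = M * M.
  rewrite /E (fubini_tonelli1 _ (mM _ _ mb mc) (M0 _ _ b0 c0)).
  transitivity (\int[P]_x (M * m2 x)).
    apply: eq_integral => x _; rewrite /fubini_F /b /c /= ge0_integralTZl//.
    rewrite muleC; congr (_ * _).
    by rewrite /M (fubini_tonelli2 a ma a0).
  by rewrite ge0_integralTZl//; congr (_ * _); rewrite /M (fubini_tonelli1 a ma a0).
have Moo : M < +oo by exact: (integral_lty_sqr (P := P \x Q) mh h0 Hoo).
have Mfin : M \is a fin_num by rewrite ge0_fin_numE.
have mh2 : measurable_fun setT (fun z => (h z ^+ 2)%:E).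
  by apply/measurable_EFinP; exact: measurable_funX.
have h2_ge0 z : 0 <= (h z ^+ 2)%:E by rewrite lee_fin sqr_ge0.
(* Jensen on each slice makes [A], and likewise [B], finite; both have to be cancelled at the
   end. *)
have AH : A <= H.
  rewrite /H (fubini_tonelli1 _ mh2 h2_ge0); apply: ge0_le_integralT.
  - exact: measurable_sq.
  - by move=> x; exact/expe2_ge0/m2_ge0.
  - exact: measurable_fun_fubini_tonelli_F.
  - move=> x; apply: sqr_integral_le => [|v]; last exact: h0.
    exact: (measurableT_comp mh (pair1_measurable x)).
have BH : B <= H.
  rewrite /H (fubini_tonelli2 _ mh2 h2_ge0); apply: ge0_le_integralT.
  - exact: measurable_sq.
  - by move=> v; exact/expe2_ge0/m1_ge0.
  - exact: measurable_fun_fubini_tonelli_G.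
  - move=> v; apply: sqr_integral_le => [|x]; last exact: h0.
    exact: (measurableT_comp mh (pair2_measurable v)).
have A_ge0 : 0 <= A by apply: integral_ge0 => x _; exact/expe2_ge0/m2_ge0.
have B_ge0 : 0 <= B by apply: integral_ge0 => x _; exact/expe2_ge0/m1_ge0.
have Afin : A \is a fin_num by rewrite ge0_fin_numE// (le_lt_trans AH).
have Bfin : B \is a fin_num by rewrite ge0_fin_numE// (le_lt_trans BH).
have two0 : 0 <= 2%:E :> \bar R by rewrite lee_fin.
have mba := mM _ _ mb ma; have mca := mM _ _ mc ma; have mbc := mM _ _ mb mc.
have mbb := mM _ _ mb mb; have mcc := mM _ _ mc mc.
have ba0 := M0 _ _ b0 a0; have ca0 := M0 _ _ c0 a0; have bc0 := M0 _ _ b0 c0.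
have bb0 := M0 _ _ b0 b0; have cc0 := M0 _ _ c0 c0.
have mcst (r : \bar R) : measurable_fun setT (fun _ : T1 * T2 => r) by [].
have key : E (fun z => 2%:E * ((b z * a z + c z * a z) + M * (b z + c z))) <=
    E (fun z => ((h z ^+ 2)%:E + (b z * b z + c z * c z)) +
                2%:E * (M * a z + b z * c z) + M * M).
  apply: ge0_le_integralT.
  - exact: (mM _ _ (mcst _) (mD _ _ (mD _ _ mba mca) (mM _ _ (mcst _) (mD _ _ mb mc)))).
  - move=> z; apply: mule_ge0 => //; apply: adde_ge0; first exact: adde_ge0.
    by apply: mule_ge0 => //; exact: adde_ge0.
  - apply: (mD _ _ (mD _ _ (mD _ _ mh2 (mD _ _ mbb mcc)) _) (mcst _)).
    exact: (mM _ _ (mcst _) (mD _ _ (mM _ _ (mcst _) ma) mbc)).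
  - by move=> z; rewrite -(fineK Mfin); apply: cross_terms_le; rewrite ?fine_ge0.
have Ma0 z : 0 <= M * a z by exact: mule_ge0.
have Mbc0 z : 0 <= M * (b z + c z) by apply: mule_ge0 => //; exact: adde_ge0.
have mMa := mM _ _ (mcst M) ma.
have mMbc := mM _ _ (mcst M) (mD _ _ mb mc).
move: key; rewrite /E.
rewrite (ge0_integralTZl _ (mD _ _ (mD _ _ mba mca) mMbc)
  (D0 _ _ (D0 _ _ ba0 ca0) Mbc0) two0).
rewrite (ge0_integralTD _ (mD _ _ mba mca) (D0 _ _ ba0 ca0) mMbc Mbc0).
rewrite (ge0_integralTD _ mba ba0 mca ca0).
rewrite (ge0_integralTZl _ (mD _ _ mb mc) (D0 _ _ b0 c0) M_ge0).
rewrite (ge0_integralTD _ mb b0 mc c0).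
rewrite (ge0_integralTD _ (mD _ _ (mD _ _ mh2 (mD _ _ mbb mcc))
    (mM _ _ (mcst _) (mD _ _ mMa mbc)))
  (D0 _ _ (D0 _ _ h2_ge0 (D0 _ _ bb0 cc0)) (M0 _ _ (fun=> two0) (D0 _ _ Ma0 bc0)))
  (mcst _) (fun=> mule_ge0 M_ge0 M_ge0)).
rewrite (ge0_integralTD _ (mD _ _ mh2 (mD _ _ mbb mcc)) (D0 _ _ h2_ge0 (D0 _ _ bb0 cc0))
  (mM _ _ (mcst _) (mD _ _ mMa mbc)) (M0 _ _ (fun=> two0) (D0 _ _ Ma0 bc0))).
rewrite (ge0_integralTD _ mh2 h2_ge0 (mD _ _ mbb mcc) (D0 _ _ bb0 cc0)).
rewrite (ge0_integralTD _ mbb bb0 mcc cc0).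
rewrite (ge0_integralTZl _ (mD _ _ mMa mbc) (D0 _ _ Ma0 bc0) two0).
rewrite (ge0_integralTD _ mMa Ma0 mbc bc0) (ge0_integralTZl _ ma a0 M_ge0).
rewrite (integral_probability_cst (P \x Q)).
rewrite -/(E (fun z => b z * a z)) -/(E (fun z => c z * a z)) -/(E b) -/(E c).
rewrite -/(E (fun z => b z * b z)) -/(E (fun z => c z * c z)) -/(E (fun z => b z * c z)).
rewrite Eab Eac Eb Ec Ebb Ecc Ebc -/H -[\int[_]_z a z]/M.
move: AH BH Hoo; rewrite expe2 -(fineK Mfin) -(fineK Afin) -(fineK Bfin).
(* With every integral evaluated, the inequality reads [2 (A + B + 2 M^2) <= H + A + B + 4 M^2 +
   M^2]. *)
case: H => [r| |]//; rewrite !(=^~ EFinM, =^~ EFinD) !lee_fin => ? ? _ ?; lra.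
Qed.

End efron_stein.

(** * The Gaussian Poincare inequality in dimension n *)

Section gauss_poincare.
Context {R : realType}.

Lemma is_derive_shift0 (f : R -> R) (x d : R) :
  is_derive (0 : R) (1 : R) (fun t => f (x + t)) d -> is_derive x (1 : R) f d.
Proof.
have E : (fun t : R => t^-1 *: (((fun t => f (x + t)) \o shift 0) (t *: 1) - f (x + 0))) =
         (fun t : R => t^-1 *: ((f \o shift x) (t *: 1) - f x)).
  by apply/funext => t; rewrite /= !addr0 (addrC x).
move=> [df fE]; split; first by rewrite /derivable -E; exact: df.
by rewrite -fE /derive E.
Qed.

(** Regularity is asked along coordinate lines only: this is what the one-dimensional inequality
    consumes, and it passes to slices with a frozen coordinate, as the induction requires. *)
Definition coord_C1 n (h : 'cV[R]_n -> R) (D : 'I_n -> 'cV[R]_n -> R) :=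
  forall i z,
    is_derive (0 : R) (1 : R) (fun t : R => h (z + t *: delta_mx i ord0)%R) (D i z) /\
    continuous (fun t : R => D i (z + t *: delta_mx i ord0)%R).

Lemma cV_cons_shift0 n (x t : R) (v : 'cV[R]_n) :
  (cV_cons (x, v) + t *: delta_mx ord0 ord0)%R = cV_cons (x + t, v)%R.
Proof.
apply/colP => i; rewrite !mxE; case: unliftP => [j|] -> /=.
  by rewrite mulr0 addr0.
by rewrite mulr1.
Qed.

Lemma cV_cons_shiftS n (x t : R) (v : 'cV[R]_n) (j : 'I_n) :
  (cV_cons (x, v) + t *: delta_mx (lift ord0 j) ord0)%R =
  cV_cons (x, v + t *: delta_mx j ord0)%R.
Proof.
apply/colP => i; rewrite !mxE; case: unliftP => [k|] -> /=.
  by rewrite !mxE (inj_eq lift_inj).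
by rewrite mulr0 addr0.
Qed.

Lemma integral_gauss0 (g : 'cV[R]_0 -> \bar R) :
  measurable_fun setT g -> (\int[gauss 0]_z g z = g 0%R)%E.
Proof. by move=> mg; rewrite /= integral_dirac// diracT mul1e. Qed.

Local Open Scope ereal_scope.

Lemma integral_gaussS_prod n (g : 'cV[R]_n.+1 -> \bar R) :
  measurable_fun setT g -> (forall z, 0 <= g z) ->
  \int[gauss n.+1]_z g z =
  \int[normal_prob 0%R 1%R \x gauss n]_p g (cV_cons p).
Proof.
move=> mg g0.
by rewrite /= /distribution ge0_integral_pushforward// preimage_setT.
Qed.

(** Let [A] and [B] be the mean squares of the two partial means, [H] the second moment and [M] the
    mean. Poincare in the first coordinate bounds [H] by [B] plus its energy, and the induction
    hypothesis bounds [H] by [A] plus the remaining energy. Adding the two and using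
    [A + B <= H + M^2], one copy of the finite [H] cancels. *)
Lemma gauss_poincare n (h : 'cV[R]_n -> R) (D : 'I_n -> 'cV[R]_n -> R) :
  measurable_fun setT h -> (forall i, measurable_fun setT (D i)) ->
  (forall z, (0 <= h z)%R) -> coord_C1 h D ->
  \int[gauss n]_z (h z ^+ 2)%:E < +oo ->
  \int[gauss n]_z (h z ^+ 2)%:E <=
  (\int[gauss n]_z (h z)%:E) ^+ 2 +
  \int[gauss n]_z (\sum_(i < n) D i z ^+ 2)%:E.
Proof.
elim: n h D => [|n IHn] h D mh mD h0 hD h2oo.
  rewrite !integral_gauss0; last 3 first.
  - apply/measurable_EFinP; under eq_fun do rewrite big_ord0.
    exact: measurable_cst.
  - by apply/measurable_EFinP; exact: mh.
  - by apply/measurable_EFinP; apply: measurable_funX; exact: mh.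
  by rewrite big_ord0 adde0 expe2 -EFinM -expr2.
pose P : probability _ R := normal_prob 0%R 1%R; pose Q : probability _ R := gauss n.
have mE d (T : measurableType d) (u : T -> R) : measurable_fun setT u ->
  measurable_fun setT (fun z => (u z)%:E) by move=> mu; exact/measurable_EFinP.
have sq0 (r : R) : 0 <= (r ^+ 2)%:E by rewrite lee_fin sqr_ge0.
have mcons := @measurable_cV_cons R n.
pose k p := h (cV_cons p).
have mk : measurable_fun setT k by exact: (measurableT_comp mh mcons).
have mk2 : measurable_fun setT (fun p => (k p ^+ 2)%:E).
  by apply: mE; exact: measurable_funX.
have mDk i : measurable_fun setT (fun p => D i (cV_cons p)).
  exact: (measurableT_comp (mD i) mcons).
have mD0 : measurable_fun setT (fun p => (D ord0 (cV_cons p) ^+ 2)%:E).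
  by apply: mE; exact: measurable_funX.
pose S p := (\sum_(i < n) D (lift ord0 i) (cV_cons p) ^+ 2)%R.
have mS : measurable_fun setT (fun p => (S p)%:E).
  by apply: mE; apply: measurable_sum => i; exact: measurable_funX.
have S0 p : 0 <= (S p)%:E by rewrite lee_fin sumr_ge0// => i _; exact: sqr_ge0.
move: h2oo; rewrite integral_gaussS_prod; [|by apply: mE; exact: measurable_funX|by []].
rewrite integral_gaussS_prod; [|exact: mE|by move=> z; rewrite lee_fin].
rewrite integral_gaussS_prod; last 2 first.
- by apply: mE; apply: measurable_sum => i; exact: measurable_funX.
- by move=> z; rewrite lee_fin sumr_ge0// => i _; exact: sqr_ge0.
rewrite -/P -/Q; set H := \int[_]_p (h _ ^+ 2)%:E; set M := \int[_]_p (h _)%:E => Hoo.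
have -> : \int[P \x Q]_p (\sum_(i < n.+1) D i (cV_cons p) ^+ 2)%:E =
    \int[P \x Q]_p (D ord0 (cV_cons p) ^+ 2)%:E + \int[P \x Q]_p (S p)%:E.
  rewrite -(ge0_integralTD _ mD0 (fun=> sq0 _) mS S0).
  by apply: eq_integral => p _; rewrite big_ord_recl EFinD.
pose A := \int[P]_x (\int[Q]_v (k (x, v))%:E) ^+ 2.
pose B := \int[Q]_v (\int[P]_x (k (x, v))%:E) ^+ 2.
have k2_ge0 p : 0 <= (k p ^+ 2)%:E by exact: sq0.
have mk1 x : measurable_fun setT (fun v => k (x, v)).
  exact: (measurableT_comp mk (pair1_measurable x)).
have k_ge0 p : 0 <= (k p)%:E by rewrite lee_fin; exact: h0.
have mI1 : measurable_fun setT (fun x => \int[Q]_v (k (x, v))%:E).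
  exact: (measurable_fun_fubini_tonelli_F (fun p => (k p)%:E) (mE _ _ _ mk) k_ge0).
have mI2 : measurable_fun setT (fun v => \int[P]_x (k (x, v))%:E).
  exact: (measurable_fun_fubini_tonelli_G (fun p => (k p)%:E) (mE _ _ _ mk) k_ge0).
have mI1s : measurable_fun setT (fun x => (\int[Q]_v (k (x, v))%:E) ^+ 2).
  by under eq_fun do rewrite expe2; exact: emeasurable_funM.
have mI2s : measurable_fun setT (fun v => (\int[P]_x (k (x, v))%:E) ^+ 2).
  by under eq_fun do rewrite expe2; exact: emeasurable_funM.
have I1_ge0 x : 0 <= (\int[Q]_v (k (x, v))%:E) ^+ 2.
  by apply/expe2_ge0/integral_ge0 => v _; exact: k_ge0.
have I2_ge0 v : 0 <= (\int[P]_x (k (x, v))%:E) ^+ 2.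
  by apply/expe2_ge0/integral_ge0 => x _; exact: k_ge0.
have HB : H <= B + \int[P \x Q]_p (D ord0 (cV_cons p) ^+ 2)%:E.
  rewrite /H (fubini_tonelli2 _ mk2 k2_ge0) (fubini_tonelli2 _ mD0 (fun=> sq0 _)).
  have mG := measurable_fun_fubini_tonelli_G (m1 := P) _ mD0 (fun=> sq0 _).
  have G0 v : 0 <= fubini_G P (fun p => (D ord0 (cV_cons p) ^+ 2)%:E) v.
    by apply: integral_ge0.
  rewrite /B -(ge0_integralTD _ mI2s I2_ge0 mG G0).
  apply: ge0_le_integralT.
  - exact: (measurable_fun_fubini_tonelli_G (m1 := P) _ mk2).
  - by move=> v; exact: integral_ge0.
  - exact: emeasurable_funD.
  move=> v; apply: gauss_poincare1.
  - move=> x; apply: is_derive_shift0; have [+ _] := hD ord0 (cV_cons (x, v)).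
    by under eq_fun do rewrite cV_cons_shift0.
  - have [_] := hD ord0 (cV_cons (0%R, v)).
    by under eq_fun do rewrite cV_cons_shift0 add0r.
  - by move=> x; exact: h0.
have HA : H <= A + \int[P \x Q]_p (S p)%:E.
  have mF2 := measurable_fun_fubini_tonelli_F (m2 := Q) _ mk2 k2_ge0.
  have F2_ge0 x : 0 <= fubini_F Q (fun p => (k p ^+ 2)%:E) x by exact: integral_ge0.
  have HF : H = \int[P]_x fubini_F Q (fun p => (k p ^+ 2)%:E) x.
    exact: (fubini_tonelli1 _ mk2 k2_ge0).
  have mFS := measurable_fun_fubini_tonelli_F (m2 := Q) _ mS S0.
  have FS0 x : 0 <= fubini_F Q (fun p => (S p)%:E) x by exact: integral_ge0.
  (* A finite total second moment is finite on almost every slice, and there the induction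
     hypothesis applies. *)
  have /integrable_ae : P.-integrable setT (fubini_F Q (fun p => (k p ^+ 2)%:E)).
    apply/integrableP; split => //.
    by under eq_integral do rewrite gee0_abs//; rewrite -HF.
  move=> /(_ measurableT) aefin.
  rewrite HF (fubini_tonelli1 _ mS S0) /A -(ge0_integralTD _ mI1s I1_ge0 mFS FS0).
  apply: ae_ge0_le_integral => //.
  - by move=> x _; exact: adde_ge0.
  - exact: emeasurable_funD.
  apply: filterS aefin => x /(_ Logic.I) xfin _.
  apply: (IHn (fun v => k (x, v)) (fun i v => D (lift ord0 i) (cV_cons (x, v)))).
  - exact: mk1.
  - by move=> i; exact: (measurableT_comp (mDk _) (pair1_measurable x)).
  - by move=> v; exact: h0.
  - move=> i v; have [+ +] := hD (lift ord0 i) (cV_cons (x, v)).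
    under eq_fun do rewrite cV_cons_shiftS.
    by under [X in continuous X -> _]eq_fun do rewrite cV_cons_shiftS.
  - by move: xfin; rewrite ge0_fin_numE.
have ES : A + B <= H + M ^+ 2 by exact: (efron_stein (P := P) (Q := Q) mk (fun=> h0 _) Hoo).
have D0_ge0 : 0 <= \int[P \x Q]_p (D ord0 (cV_cons p) ^+ 2)%:E by exact: integral_ge0.
have DS_ge0 : 0 <= \int[P \x Q]_p (S p)%:E by exact: integral_ge0.
have H_ge0 : 0 <= H by exact: integral_ge0.
have Hfin : H \is a fin_num by rewrite ge0_fin_numE.
move: HA HB ES D0_ge0 DS_ge0; move: Hfin.
move: (\int[P \x Q]_p (D ord0 (cV_cons p) ^+ 2)%:E) (\int[P \x Q]_p (S p)%:E) => X Y.
move=> Hfin HA HB ES X0 Y0; rewrite -(@leeD2lE _ H)//.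
apply: (le_trans (leeD HB HA)); rewrite [leLHS]addeACA (addeC B) [leRHS]addeA.
exact: (leeD ES (lexx _)).
Qed.

End gauss_poincare.

(** * Calculus for the log-likelihood *)

Section continuous_measurable_cV.
Context {R : realType}.

(** The sigma-algebra is generated by coordinates, so an open set is exhibited as the countable
    union of the boxes with rational centre and radius [1/(k+1)] that it contains. *)
Lemma open_measurable_cV n (O : set 'cV[R]_n) : open O -> measurable O.
Proof.
move=> oO; pose box (p : 'cV[rat]_n * nat) : set 'cV[R]_n :=
  [set x | forall i, ball (ratr (p.1 i ord0) : R) (p.2.+1%:R^-1) (x i ord0)].
have mbox p : measurable (box p).
  by apply: (measurable_cV_box (A := fun i => ball _ _)) => i; exact: measurable_ball.
have -> : O = \bigcup_p (if `[< box p `<=` O >] then box p else set0).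
  apply/seteqP; split => [x Ox|x [p _]]; last first.
    by case: ifPn => // /asboolP; exact.
  have [e /= e0 xeO] : nbhs_ball x O by apply/nbhs_ballP; exact: open_nbhs_nbhs.
  (* The box is centred within [dk] of [x], so its points are within [2 dk] of [x]; this choice of
     [k] makes [2 dk < e]. *)
  pose k := Num.trunc (2 / e); pose dk : R := k.+1%:R^-1.
  have dk0 : 0 < dk by rewrite invr_gt0.
  have dke : 2 * dk < e.
    by rewrite /dk ltr_pdivrMr// -ltr_pdivrMl// mulrC truncnS_gt.
  have /choice[q qP] (i : 'I_n) : exists q : rat, `|ratr q - x i ord0| < dk.
    have xdk : x i ord0 - dk < x i ord0 + dk by lra.
    have [q] := rat_in_itvoo xdk; rewrite in_itv/= => /andP[q1 q2].
    by exists q; rewrite ltr_norml; lra.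
  exists (\col_i q i, k) => //; rewrite asboolT.
    by move=> i; rewrite /ball/= mxE; exact: qP.
  move=> y yb; apply: xeO; split=> // i j; rewrite (ord1 j) /ball/=.
  have := yb i; rewrite /ball/= mxE -/dk => yq; have := qP i => xq.
  rewrite (le_lt_trans _ dke)// -(subrKA (ratr (q i))) (le_trans (ler_normD _ _))//.
  by rewrite distrC; lra.
apply: countable_bigcupT_measurable; first exact: countableP.
by move=> p; case: ifP.
Qed.

Lemma continuous_measurable_cV n (g : 'cV[R]_n -> R) :
  continuous g -> measurable_fun setT g.
Proof.
move=> /continuousP cg; apply: (measurability _ (RGenOpens.measurableE R)).
move=> _ [_ [a [b ->] <-]]; rewrite setTI; apply: open_measurable_cV.
exact/cg/interval_open.
Qed.

End continuous_measurable_cV.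

Section log_likelihood_calculus.
Context {R : realType} {d : nat}.
Variables (L : 'cV[R]_d -> R) (S : 'cV[R]_d -> 'cV[R]_d).
Hypotheses (L_gt0 : forall x, 0 < L x) (L_C1 : C1 L) (S_C1 : C1 S).

Let l z := ln (L (S z)).

Lemma cV_sum_delta n (w : 'cV[R]_n) : w = \sum_i w i ord0 *: delta_mx i ord0.
Proof.
by rewrite [LHS]matrix_sum_delta; apply: eq_bigr => i _; rewrite big_ord1.
Qed.

Lemma continuous_coord n (i : 'I_n) : continuous (fun x : 'cV[R]_n => x i ord0).
Proof. exact: coord_continuous. Qed.

Lemma continuous_sumr (T : topologicalType) (I : Type) (r : seq I)
    (g : I -> T -> R) : (forall i, continuous (g i)) ->
  continuous (fun z => \sum_(i <- r) g i z).
Proof.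
move=> cg; elim: r => [|i r IHr] z.
  by under eq_fun do rewrite big_nil; exact: cvg_cst.
by under eq_fun do rewrite big_cons; apply: (@cvgD _ _ _ (nbhs z)); [exact: cg|exact: IHr].
Qed.

Lemma continuous_mulr (T : topologicalType) (g h : T -> R) :
  continuous g -> continuous h -> continuous (fun z => g z * h z).
Proof. by move=> cg ch z; apply: (@cvgM _ _ (nbhs z)); [exact: cg|exact: ch]. Qed.

Let dLS z : differentiable (L \o S) z.
Proof. by apply: differentiable_comp; [exact: S_C1.1|exact: L_C1.1]. Qed.

Let cLS : continuous (L \o S).
Proof. by move=> z; apply: differentiable_continuous; exact: dLS. Qed.

Let DLSE v z : 'D_v (L \o S) z =
  \sum_i ('D_v S z) i ord0 * 'D_(delta_mx i ord0) L (S z).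
Proof.
rewrite deriveE// diff_comp; [|exact: S_C1.1|exact: L_C1.1].
rewrite /= -(deriveE _ (S_C1.1 z)) [X in 'd _ _ X]cV_sum_delta linear_sum.
by apply: eq_bigr => i _; rewrite linearZ /= (deriveE _ (L_C1.1 _)).
Qed.

Lemma differentiable_log_likelihood z : differentiable l z.
Proof.
apply: (@differentiable_comp _ _ _ _ (L \o S) (@ln R)) => //.
by apply/derivable1_diffP; case: (is_derive1_ln (L_gt0 (S z))).
Qed.

Lemma derive_log_likelihoodE v z :
  'D_v l z = (L (S z))^-1 * 'D_v (L \o S) z.
Proof.
have dln : derivable (@ln R) (L (S z)) 1 by case: (is_derive1_ln (L_gt0 (S z))).
rewrite deriveE; last exact: differentiable_log_likelihood.
rewrite (@diff_comp _ _ _ _ (L \o S) (@ln R))//; last exact/derivable1_diffP.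
rewrite /= deriv1E// -deriveE// derive1E.
have [_ ->] := is_derive1_ln (L_gt0 (S z)).
by rewrite /GRing.scale/= mulrC.
Qed.

(** [C1] speaks of one direction at a time, so the chain rule is expanded over the coordinates of
    ['D_v S z] before continuity is read off. *)
Lemma continuous_derive_log_likelihood v : continuous (fun z => 'D_v l z).
Proof.
have -> : (fun z => 'D_v l z) = (fun z => (L (S z))^-1 *
    \sum_i ('D_v S z) i ord0 * 'D_(delta_mx i ord0) L (S z)).
  by apply/funext => z; rewrite derive_log_likelihoodE DLSE.
apply: continuous_mulr.
  move=> z; apply: (@continuous_comp _ _ _ (L \o S) GRing.inv); first exact: cLS.
  by apply: inv_continuous; rewrite /= gt_eqF.
apply: continuous_sumr => i; apply: continuous_mulr => z.
  apply: (@continuous_comp _ _ _ (fun z => 'D_v S z) (fun x : 'cV[R]_d => x i ord0)).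
    exact: S_C1.2.
  exact: continuous_coord.
apply: (@continuous_comp _ _ _ S (fun x => 'D_(delta_mx i ord0) L x)); last exact: L_C1.2.
by apply: differentiable_continuous; exact: S_C1.1.
Qed.

Lemma derive_log_likelihood_score v z :
  'D_v l z = \sum_i v i ord0 * score L S z i ord0.
Proof.
rewrite deriveE; last exact: differentiable_log_likelihood.
rewrite [X in 'd _ _ X]cV_sum_delta linear_sum.
apply: eq_bigr => i _; rewrite linearZ /= /score /grad mxE deriveE//.
exact: differentiable_log_likelihood.
Qed.

(** In this form the root is differentiated through [expR], and the derivative of the log-likelihood
    appears as a factor. *)
Lemma sqrt_likelihoodE z : Num.sqrt (L (S z)) = expR (2^-1 * l z).
Proof.
rewrite -[LHS](@lnK R) ?posrE ?sqrtr_gt0//; congr expR.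
have : ln (Num.sqrt (L (S z)) ^+ 2) = 2 * ln (Num.sqrt (L (S z))).
  by rewrite lnXn ?sqrtr_gt0// mulr_natl.
by rewrite sqr_sqrtr ?ltW// => E; rewrite /l E mulKf.
Qed.

Lemma is_derive_sqrt_likelihood (v z : 'cV[R]_d) :
  is_derive (0 : R) (1 : R) (fun t : R => Num.sqrt (L (S (z + t *: v))))
    (2^-1 * Num.sqrt (L (S z)) * 'D_v l z).
Proof.
under eq_fun do rewrite sqrt_likelihoodE.
have dl : is_derive (0 : R) (1 : R) (fun t : R => l (z + t *: v)) ('D_v l z).
  have E : (fun t : R => t^-1 *:
      (((fun t => l (z + t *: v)) \o shift 0) (t *: 1) - l (z + 0 *: v))) =
         (fun t : R => t^-1 *: ((l \o shift z) (t *: v) - l z)).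
    by apply/funext => t; rewrite /= scale0r !addr0 /GRing.scale/= mulr1 (addrC z).
  have dv : derivable l z v.
    by apply: diff_derivable; exact: differentiable_log_likelihood.
  by split; [rewrite /derivable E|rewrite /derive E].
have dl2 : is_derive (0 : R) (1 : R) (fun t : R => 2^-1 * l (z + t *: v)) (2^-1 * 'D_v l z).
  exact: (is_deriveZ (2^-1) dl).
have := @is_derive1_comp _ expR (fun t : R => 2^-1 * l (z + t *: v)) 0 _ _
  (is_derive_expR _) dl2.
by rewrite sqrt_likelihoodE scale0r addr0 mulrCA mulrA.
Qed.

Lemma continuous_sqrt_likelihood : continuous (fun z => Num.sqrt (L (S z))).
Proof.
move=> z; apply: (@continuous_comp _ _ _ (L \o S) (@Num.sqrt R)); first exact: cLS.
exact: sqrt_continuous.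
Qed.

End log_likelihood_calculus.

(** * Dimension reduction under the Gaussian measure *)

Lemma measurable_sqrt (R : realType) : measurable_fun setT (@Num.sqrt R).
Proof. by apply: continuous_measurable_fun; exact: sqrt_continuous. Qed.

Section gauss_dimension_reduction.
Context {R : realType}.
Local Open Scope ereal_scope.

Let mE d (T : measurableType d) (u : T -> R) :
  measurable_fun setT u -> measurable_fun setT (fun z => (u z)%:E).
Proof. by move=> mu; exact/measurable_EFinP. Qed.

Let sq0 (r : R) : 0 <= (r ^+ 2)%:E.
Proof. by rewrite lee_fin sqr_ge0. Qed.

(** The centring is at [sqrt g], the root of the second moment, and not at the mean [m] of [u]. The
    error is therefore [2 (g - m sqrt g)], up to twice the variance, whence the factor 2. *)
Lemma gauss_sqrt_energy k (u : 'cV[R]_k -> R) (D : 'I_k -> 'cV[R]_k -> R) (g : R) :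
  measurable_fun setT u -> (forall i, measurable_fun setT (D i)) ->
  (forall b, (0 <= u b)%R) -> coord_C1 u D ->
  \int[gauss k]_b (u b ^+ 2)%:E = g%:E ->
  \int[gauss k]_b ((u b - Num.sqrt g) ^+ 2)%:E <=
  2%:E * \int[gauss k]_b (\sum_(i < k) D i b ^+ 2)%:E.
Proof.
move=> mu mD u0 uD gE.
have g0 : (0 <= g)%R by rewrite -lee_fin -gE; exact: integral_ge0.
have goo : \int[gauss k]_b (u b ^+ 2)%:E < +oo by rewrite gE ltry.
have := gauss_poincare mu mD u0 uD goo.
have := sqr_integral_le (gauss k) mu u0.
have := integral_lty_sqr (P := gauss k) mu u0 goo.
set m := \int[gauss k]_b (u b)%:E; set X := \int[_]_b (\sum_(_ < k) _)%:E.
have m0 : 0 <= m by apply: integral_ge0 => b _; rewrite lee_fin.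
rewrite -ge0_fin_numE// => mfin; rewrite gE.
have X0 : 0 <= X.
  by apply: integral_ge0 => b _; rewrite lee_fin sumr_ge0// => i _; exact: sqr_ge0.
set I := \int[_]_b _.
have I0 : 0 <= I by apply: integral_ge0 => b _; exact: sq0.
have mu2 : measurable_fun setT (fun b => (u b ^+ 2)%:E).
  by apply: mE; exact: measurable_funX.
have mI : measurable_fun setT (fun b => ((u b - Num.sqrt g) ^+ 2)%:E).
  by apply: mE; apply: measurable_funX; exact: measurable_funB.
have mu1 : measurable_fun setT (fun b => (u b)%:E) by exact: mE.
have u1 b : 0 <= (u b)%:E by rewrite lee_fin.
have c0 : 0 <= (2 * Num.sqrt g)%:E by rewrite lee_fin mulr_ge0.
have mcu : measurable_fun setT (fun b => (2 * Num.sqrt g)%:E * (u b)%:E).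
  by apply: emeasurable_funM => //; exact: measurable_cst.
have cu0 b : 0 <= (2 * Num.sqrt g)%:E * (u b)%:E by exact: mule_ge0.
have IE : I + (2 * Num.sqrt g)%:E * m = g%:E + g%:E.
  have ge0 : 0 <= g%:E by rewrite lee_fin.
  rewrite /I /m -(ge0_integralTZl _ mu1 u1 c0) -(ge0_integralTD _ mI (fun=> sq0 _) mcu cu0).
  rewrite -[X in _ = X + _]gE -[X in _ = _ + X](integral_probability_cst (gauss k)).
  rewrite -(ge0_integralTD _ mu2 (fun=> sq0 _) (measurable_cst _) (fun=> ge0)).
  apply: eq_integral => b _; rewrite -EFinM -!EFinD; congr (_%:E).
  by rewrite sqrrB sqr_sqrtr//; ring.
move: IE I0 m0; rewrite -(fineK mfin); case: I => [I| |]//.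
rewrite expe2 -!EFinM -!EFinD => -[IE]; rewrite !lee_fin => I0 m0 mg.
case: X X0 => [X| |]//; last by rewrite mulry gtr0_sg// mul1e !leey.
rewrite -EFinM -EFinD !lee_fin => X0 gmX.
(* Jensen, in the form that gives [m sqrt g >= m^2]. *)
have : (fine m <= Num.sqrt g)%R by rewrite -[leLHS]ger0_norm// -sqrtr_sqr ler_wsqrtr.
have := sqr_sqrtr g0; have := sqrtr_ge0 g.
nra.
Qed.

Variables (d r k : nat) (U : 'M[R]_(d, r)) (V : 'M[R]_(d, k)) (F : 'cV[R]_d -> R).
Hypotheses (drk : d = (r + k)%N) (UU : orthonormal_cols U)
  (VV : orthonormal_cols V) (UV : U^T *m V = 0%R).
Hypotheses (mF : measurable_fun setT F) (F0 : forall z, (0 <= F z)%R).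

Let g a := \int[gauss k]_b (F (U *m a + V *m b))%:E.

Let mUV : measurable_fun setT
  (fun p : 'cV[R]_r * 'cV[R]_k => U *m p.1 + V *m p.2)%R.
Proof.
apply: measurable_addmx.
  exact: (measurableT_comp (measurable_mulmxl U) measurable_fst).
exact: (measurableT_comp (measurable_mulmxl V) measurable_snd).
Qed.

Let mV a : measurable_fun setT (fun b : 'cV[R]_k => U *m a + V *m b)%R.
Proof. exact: (measurableT_comp mUV (pair1_measurable a)). Qed.

Let mfiber (f : 'cV[R]_d -> \bar R) : measurable_fun setT f -> (forall z, 0 <= f z) ->
  measurable_fun setT (fun a => \int[gauss k]_b f (U *m a + V *m b)%R).
Proof.
move=> mf f0; apply: (measurable_fun_fubini_tonelli_F
  (fun p : 'cV[R]_r * 'cV[R]_k => f (U *m p.1 + V *m p.2)%R)).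
  exact: (measurableT_comp mf mUV).
by move=> p; exact: f0.
Qed.

Let EF0 z : 0 <= (F z)%:E. Proof. by rewrite lee_fin. Qed.

Let g0 a : 0 <= g a. Proof. by apply: integral_ge0 => b _; exact: EF0. Qed.

Let fine_g0 a : (0 <= fine (g a))%R. Proof. exact/fine_ge0/g0. Qed.

Let UTE (a : 'cV[R]_r) (b : 'cV[R]_k) : U^T *m (U *m a + V *m b) = a.
Proof. by rewrite mulmxDr !mulmxA UU UV mul1mx mul0mx addr0. Qed.

Lemma measurable_marginal_proj : measurable_fun setT (fun z => fine (g (U^T *m z))).
Proof.
apply: (measurableT_comp (f := fine)); first exact: fine_measurable.
exact: (measurableT_comp (mfiber (mE mF) EF0) (measurable_mulmxl U^T)).
Qed.

Let err z := ((Num.sqrt (F z) - Num.sqrt (fine (g (U^T *m z)))) ^+ 2)%:E.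

Let mer : measurable_fun setT err.
Proof.
apply: mE; apply: measurable_funX; apply: measurable_funB.
  exact: (measurableT_comp (@measurable_sqrt R)).
exact: (measurableT_comp (@measurable_sqrt R) measurable_marginal_proj).
Qed.

(** For nonnegative [x] and [y], [(x - y)^2 <= x^2 + y^2], and on a fibre of finite mass both
    squares integrate to [g a]. The bound is free of derivatives, which makes it uniform in the map
    and in the subspace. *)
Lemma gauss_reduction_le_mass :
  \int[gauss d]_z ((Num.sqrt (F z) - Num.sqrt (fine (g (U^T *m z)))) ^+ 2)%:E <=
  2%:E * \int[gauss d]_z (F z)%:E.
Proof.
have two0 : 0 <= 2%:E :> \bar R by rewrite lee_fin.
rewrite (integral_gauss_frame drk UU VV UV mer (fun=> sq0 _)).
rewrite (integral_gauss_frame drk UU VV UV (mE mF) EF0).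
rewrite -(ge0_integralTZl _ (mfiber (mE mF) EF0) g0 two0).
have mFa a : measurable_fun setT (fun b => (F (U *m a + V *m b))%:E).
  exact: (measurableT_comp (mE mF) (mV a)).
apply: ge0_le_integralT.
- exact: (mfiber mer (fun=> sq0 _)).
- by move=> a; apply: integral_ge0 => b _; exact: sq0.
- by apply: emeasurable_funM; [exact: measurable_cst|exact: (mfiber (mE mF) EF0)].
move=> a; apply: (@le_trans _ _
  (\int[gauss k]_b ((F (U *m a + V *m b))%:E + (fine (g a))%:E))).
  apply: ge0_le_integralT.
  - exact: (measurableT_comp mer (mV a)).
  - by move=> b; exact: sq0.
  - by apply: emeasurable_funD; [exact: mFa|exact: measurable_cst].
  - move=> b; rewrite /err UTE -EFinD lee_fin.
    have := sqr_sqrtr (F0 (U *m a + V *m b)%R); have := sqr_sqrtr (fine_g0 a).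
    have := sqrtr_ge0 (F (U *m a + V *m b)%R); have := sqrtr_ge0 (fine (g a)).
    by move: (Num.sqrt _) (Num.sqrt _) => x y; nra.
have fg0 : 0 <= (fine (g a))%:E by rewrite lee_fin.
rewrite (ge0_integralTD _ (mFa a) (fun=> EF0 _) (measurable_cst _) (fun=> fg0)).
rewrite integral_probability_cst -[X in X + _ <= _]/(g a).
move: (g0 a); rewrite -[X in _ <= 2%:E * X]/(g a).
(* On a fibre of infinite mass [fine] returns 0, but the bound is then infinite. *)
case: (g a) => [x| |]//=; last by rewrite mulry gtr0_sg// mul1e !leey.
by move=> _; rewrite -EFinD -EFinM lee_fin; lra.
Qed.

(** [gauss_sqrt_energy] applies on each fibre where [g a] is finite, for only there is [fine (g a)]
    the fibre mass. Finiteness of the total mass makes these almost all fibres. *)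
Lemma gauss_reduction_le_energy (D : 'I_k -> 'cV[R]_d -> R) :
  (forall i, measurable_fun setT (D i)) ->
  (forall a, coord_C1 (fun b => Num.sqrt (F (U *m a + V *m b)%R))
                      (fun i b => D i (U *m a + V *m b)%R)) ->
  \int[gauss d]_z (F z)%:E < +oo ->
  \int[gauss d]_z ((Num.sqrt (F z) - Num.sqrt (fine (g (U^T *m z)))) ^+ 2)%:E <=
  2%:E * \int[gauss d]_z (\sum_(i < k) D i z ^+ 2)%:E.
Proof.
move=> mD FD; rewrite (integral_gauss_frame drk UU VV UV (mE mF) EF0) => Foo.
have two0 : 0 <= 2%:E :> \bar R by rewrite lee_fin.
have mS : measurable_fun setT (fun z => (\sum_(i < k) D i z ^+ 2)%:E).
  by apply: mE; apply: measurable_sum => i; exact: measurable_funX.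
have S0 z : 0 <= (\sum_(i < k) D i z ^+ 2)%:E.
  by rewrite lee_fin sumr_ge0// => i _; exact: sqr_ge0.
have SI0 a : 0 <= \int[gauss k]_b (\sum_(i < k) D i (U *m a + V *m b)%R ^+ 2)%:E.
  by apply: integral_ge0 => b _; exact: S0.
rewrite (integral_gauss_frame drk UU VV UV mer (fun=> sq0 _)).
rewrite (integral_gauss_frame drk UU VV UV mS S0).
rewrite -(ge0_integralTZl _ (mfiber mS S0) SI0 two0).
have mg : measurable_fun setT g := mfiber (mE mF) EF0.
have /integrable_ae : (gauss r).-integrable setT g.
  apply/integrableP; split => //.
  by under eq_integral do rewrite gee0_abs//.
move=> /(_ measurableT) aefin.
apply: (ae_ge0_le_integral measurableT).
- by move=> a _; apply: integral_ge0 => b _; exact: sq0.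
- exact: (mfiber mer (fun=> sq0 _)).
- by move=> a _; apply: mule_ge0.
- by apply: emeasurable_funM; [exact: measurable_cst|exact: (mfiber mS S0)].
apply: filterS aefin => a /(_ Logic.I) gfin _.
rewrite (eq_integral (fun b =>
  ((Num.sqrt (F (U *m a + V *m b)%R) - Num.sqrt (fine (g a))) ^+ 2)%:E)).
  apply: gauss_sqrt_energy.
  - exact: (measurableT_comp (@measurable_sqrt R) (measurableT_comp mF (mV a))).
  - by move=> i; exact: (measurableT_comp (mD i) (mV a)).
  - by move=> b; exact: sqrtr_ge0.
  - exact: FD.
  - rewrite fineK//; apply: eq_integral => b _.
    by rewrite sqr_sqrtr.
by move=> b _; rewrite /err UTE.
Qed.

End gauss_dimension_reduction.

(** * Posteriors *)

(** The left inverse of the square matrix [row_mx U V] is also its right inverse. *)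
Lemma frame_complete (R : realType) d r k (U : 'M[R]_(d, r)) (V : 'M[R]_(d, k)) :
  d = (r + k)%N -> orthonormal_cols U -> orthonormal_cols V -> U^T *m V = 0 ->
  U *m U^T + V *m V^T = 1%:M.
Proof.
move=> drk UU VV UV; subst d.
have /mulmx1C : (row_mx U V)^T *m row_mx U V = 1%:M.
  rewrite tr_row_mx mul_col_row UU VV UV.
  by rewrite -[V^T *m U]trmxK trmx_mul trmxK UV trmx0 -scalar_mx_block.
by rewrite tr_row_mx mul_row_col.
Qed.

(** By cyclicity of the trace the residual is [tr (H (1 - U U^T))], and [1 - U U^T] is the
    projection onto the complement. *)
Lemma residualE (R : realType) d r k (U : 'M[R]_(d, r)) (V : 'M[R]_(d, k)) (H : 'M[R]_d) :
  d = (r + k)%N -> orthonormal_cols U -> orthonormal_cols V -> U^T *m V = 0 ->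
  residual U H = \tr (H *m (V *m V^T)).
Proof.
move=> drk UU VV UV; rewrite /residual -mulmxA mxtrace_mulC -mulmxA.
rewrite -[X in \tr X - _]mulmx1 -(frame_complete drk UU VV UV) mulmxDr mxtraceD.
by rewrite addrC addKr.
Qed.

Section posterior_bounds.
Context {R : realType} {d : nat}.
Variables (L : 'cV[R]_d -> R) (S : 'cV[R]_d -> 'cV[R]_d).
Hypotheses (L_gt0 : forall x, 0 < L x) (L_C1 : C1 L) (S_C1 : C1 S).

Let F z := L (S z).

Lemma measurable_likelihood : measurable_fun setT (fun z => L (S z)).
Proof.
apply: continuous_measurable_cV => z; apply: differentiable_continuous.
by apply: (differentiable_comp (f := S)); [exact: S_C1.1|exact: L_C1.1].
Qed.

Let mEF : measurable_fun setT (fun z => (F z)%:E).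
Proof. by apply/measurable_EFinP; exact: measurable_likelihood. Qed.

Let F0 z : 0 <= F z. Proof. exact/ltW/L_gt0. Qed.

Let EF0 z : (0 <= (F z)%:E)%E. Proof. by rewrite lee_fin F0. Qed.

Lemma evidence_gauss : evidence L S = (\int[gauss d]_z (L (S z))%:E)%E.
Proof. by rewrite (integral_gauss mEF EF0). Qed.

Lemma marginal_gauss r (U : 'M[R]_(d, r)) (V : 'M[R]_(d, d - r)) a :
  marginal L S U V a = fine (\int[gauss (d - r)]_b (L (S (U *m a + V *m b)))%:E)%E.
Proof.
rewrite /marginal /Rintegral (@integral_gauss _ _ (fun b => (F (U *m a + V *m b))%:E))//.
apply: (measurableT_comp mEF); apply: measurable_addmx; first exact: measurable_cst.
exact: measurable_mulmxl.
Qed.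

Lemma measurable_score i : measurable_fun setT (fun z => score L S z i ord0).
Proof.
under eq_fun do rewrite mxE.
by apply: continuous_measurable_cV; exact: continuous_derive_log_likelihood.
Qed.

Lemma measurable_posterior : measurable_fun setT (posterior L S).
Proof.
apply: measurable_funM; last exact: measurable_phi0.
by apply: measurable_funM => //; exact: measurable_likelihood.
Qed.

Hypothesis Z_fin : (0 < evidence L S < +oo)%E.

Let Z := fine (evidence L S).

Let Z_gt0 : 0 < Z. Proof. by apply: fine_gt0. Qed.

Let ZE : evidence L S = Z%:E.
Proof. by rewrite fineK// gt0_fin_numE; case/andP: Z_fin. Qed.

Lemma posterior_ge0 z : 0 <= posterior L S z.
Proof.
by rewrite !mulr_ge0 ?invr_ge0 ?F0 ?(ltW Z_gt0)//; exact/ltW/phi0_gt0.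
Qed.

(** The posterior and its reduction share the constant [Z] and the Gaussian factor, which come out
    of the squared difference of roots; [c] stands for the value of the marginal. *)
Lemma sqrt_posterior_err (c : R) z : 0 <= c ->
  (Num.sqrt (posterior L S z) - Num.sqrt (Z^-1 * c * phi0 z)) ^+ 2 =
  Z^-1 * (Num.sqrt (L (S z)) - Num.sqrt c) ^+ 2 * phi0 z.
Proof.
move=> c0; have p0 : 0 <= phi0 z by exact/ltW/phi0_gt0.
have Zi0 : 0 <= Z^-1 by rewrite invr_ge0 ltW.
have ? : 0 <= Z^-1 * c by exact: mulr_ge0.
have ? : 0 <= Z^-1 * L (S z) by apply: mulr_ge0 => //; exact: F0.
rewrite /posterior -/Z !(sqrtrM (phi0 z))//.
rewrite (sqrtrM c Zi0) (sqrtrM (L (S z)) Zi0).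
by rewrite -mulrBl -mulrBr !exprMn (sqr_sqrtr Zi0) (sqr_sqrtr p0).
Qed.

Variables (r : nat) (U : 'M[R]_(d, r)) (V : 'M[R]_(d, d - r)).
Hypotheses (rd : (r <= d)%N) (UU : orthonormal_cols U)
  (VV : orthonormal_cols V) (UV : U^T *m V = 0).

Let drk : d = (r + (d - r))%N. Proof. by rewrite subnKC. Qed.

Let G z := fine (\int[gauss (d - r)]_b (L (S (U *m (U^T *m z) + V *m b)))%:E)%E.

Let G0 z : 0 <= G z.
Proof. by apply: fine_ge0; apply: integral_ge0 => b _; exact: EF0. Qed.

Lemma measurable_reduced_posterior : measurable_fun setT (reduced_posterior L S U V).
Proof.
apply: measurable_funM; last exact: measurable_phi0.
apply: measurable_funM => //; under eq_fun do rewrite marginal_gauss.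
exact: (@measurable_marginal_proj R d r (d - r) U V F measurable_likelihood F0).
Qed.

Lemma integral_sqrt_posterior_err :
  (\int[lebesgue_cV d]_z ((Num.sqrt (posterior L S z) -
     Num.sqrt (reduced_posterior L S U V z)) ^+ 2)%:E =
   (Z^-1)%:E * \int[gauss d]_z ((Num.sqrt (L (S z)) - Num.sqrt (G z)) ^+ 2)%:E)%E.
Proof.
have merr : measurable_fun setT (fun z => ((Num.sqrt (F z) - Num.sqrt (G z)) ^+ 2)%:E).
  apply/measurable_EFinP; apply: measurable_funX; apply: measurable_funB.
    exact: (measurableT_comp (@measurable_sqrt R) measurable_likelihood).
  apply: (measurableT_comp (@measurable_sqrt R)).
  exact: (@measurable_marginal_proj R d r (d - r) U V F measurable_likelihood F0).
have err0 z : (0 <= ((Num.sqrt (F z) - Num.sqrt (G z)) ^+ 2)%:E)%E.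
  by rewrite lee_fin sqr_ge0.
have Zi0 : (0 <= (Z^-1)%:E)%E by rewrite lee_fin invr_ge0 ltW.
have mphi : measurable_fun setT (fun z : 'cV[R]_d => (phi0 z)%:E).
  by apply/measurable_EFinP; exact: measurable_phi0.
rewrite (integral_gauss merr err0).
rewrite -ge0_integralTZl//; last 2 first.
- exact: emeasurable_funM.
- by move=> z; rewrite mule_ge0// lee_fin; exact/ltW/phi0_gt0.
apply: eq_integral => z _.
by rewrite /reduced_posterior marginal_gauss sqrt_posterior_err ?G0// -!EFinM mulrA.
Qed.

Lemma hellinger_sqr n (p q : 'cV[R]_n -> R) :
  hellinger p q ^+ 2 =
  2^-1 * fine (\int[lebesgue_cV n]_z ((Num.sqrt (p z) - Num.sqrt (q z)) ^+ 2)%:E)%E.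
Proof.
rewrite /hellinger sqr_sqrtr// mulr_ge0// Rintegral_ge0// => z _.
exact: sqr_ge0.
Qed.

(** The mass bound divided by [Z]. It is what keeps the constant of the second estimate independent
    of the residual. *)
Lemma integral_sqrt_posterior_err_le2 :
  (\int[lebesgue_cV d]_z ((Num.sqrt (posterior L S z) -
     Num.sqrt (reduced_posterior L S U V z)) ^+ 2)%:E <= 2%:E)%E.
Proof.
have Zi0 : (0 <= (Z^-1)%:E)%E by rewrite lee_fin invr_ge0 ltW.
rewrite integral_sqrt_posterior_err.
apply: (le_trans (lee_wpmul2l Zi0
  (gauss_reduction_le_mass drk UU VV UV measurable_likelihood F0))).
by rewrite -evidence_gauss ZE -!EFinM lee_fin mulrCA mulVf ?mulr1// gt_eqF.
Qed.

Let s_ z i := score L S z i ord0.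

Let entry (i j : 'I_d) z : R := (score L S z *m (score L S z)^T) i j * posterior L S z.

Let entryE i j z : entry i j z = s_ z i * s_ z j * posterior L S z.
Proof.
by rewrite /entry /s_; move: (score L S z) => s; rewrite mxE big_ord1 mxE.
Qed.

Let measurable_entry i j : measurable_fun setT (entry i j).
Proof.
rewrite (_ : entry i j = fun z => s_ z i * s_ z j * posterior L S z); last first.
  by apply/funext => z; exact: entryE.
apply: measurable_funM; last exact: measurable_posterior.
by apply: measurable_funM; exact: measurable_score.
Qed.

Hypothesis trH : Hmat_finite_trace L S.

Let diag_ge0 i z : 0 <= entry i i z.
Proof. by rewrite entryE -expr2 mulr_ge0 ?sqr_ge0 ?posterior_ge0. Qed.

Let integrable_diag i : (lebesgue_cV d).-integrable setT (fun z => (entry i i z)%:E).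
Proof.
apply/integrableP; split; first by apply/measurable_EFinP; exact: measurable_entry.
apply: (le_lt_trans _ trH); rewrite (bigD1 i)//=.
under eq_integral do rewrite ger0_norm//.
by rewrite leeDl// sume_ge0// => j _; apply: integral_ge0 => z _; rewrite lee_fin diag_ge0.
Qed.

(** Off-diagonal entries are dominated by diagonal ones, as [|s_i s_j| <= s_i^2 + s_j^2], and the
    diagonal is controlled by the finite trace. *)
Let integrable_entry i j : (lebesgue_cV d).-integrable setT (fun z => (entry i j z)%:E).
Proof.
apply: (le_integrable measurableT _ _
  (integrableD measurableT (integrable_diag i) (integrable_diag j))).
  by apply/measurable_EFinP; exact: measurable_entry.
move=> z _; rewrite /= lee_fin [leRHS]ger0_norm ?addr_ge0//.
rewrite !entryE -mulrDl normrM (ger0_norm (posterior_ge0 z)).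
rewrite ler_wpM2r ?posterior_ge0// ler_norml.
have := sqr_ge0 (s_ z i - s_ z j); have := sqr_ge0 (s_ z i + s_ z j).
by rewrite !expr2 => ? ?; apply/andP; split; nra.
Qed.

Let score_formE (W : 'M[R]_d) :
  (fun z => (\tr (score L S z *m (score L S z)^T *m W) * posterior L S z)%:E) =
  (fun z => \sum_i \sum_j ((W j i)%:E * (entry i j z)%:E))%E.
Proof.
apply/funext => z; rewrite /mxtrace mulr_suml -sumEFin; apply: eq_bigr => i _.
rewrite mxE mulr_suml -sumEFin; apply: eq_bigr => j _.
by rewrite -EFinM /entry mulrAC mulrC.
Qed.

Let integrable_term (W : 'M[R]_d) i j :
  (lebesgue_cV d).-integrable setT (fun z => (W j i)%:E * (entry i j z)%:E)%E.
Proof. exact: integrableZl (integrable_entry i j). Qed.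

Let integrable_score_form (W : 'M[R]_d) : (lebesgue_cV d).-integrable setT
  (fun z => (\tr (score L S z *m (score L S z)^T *m W) * posterior L S z)%:E).
Proof.
rewrite score_formE; apply: integrable_sum => // i _.
by apply: integrable_sum => // j _; exact: integrable_term.
Qed.

Lemma integral_score_form (W : 'M[R]_d) :
  (\int[lebesgue_cV d]_z (\tr (score L S z *m (score L S z)^T *m W) * posterior L S z)%:E =
   (\tr (Hmat L S *m W))%:E)%E.
Proof.
rewrite score_formE integral_sum//; last by move=> i; exact: integrable_sum.
rewrite /mxtrace -sumEFin; apply: eq_bigr => i _.
rewrite integral_sum// mxE -sumEFin; apply: eq_bigr => j _.
rewrite integralZl// mulrC EFinM; congr (_ * _)%E.
rewrite mxE /Rintegral fineK//.
exact: (integrable_fin_num measurableT (integrable_entry i j)).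
Qed.

(** On a fibre, this is the partial derivative of the root of the likelihood in the [i]-th
    coordinate of [b], since [b] moves the point along [col i V]. *)
Let D (i : 'I_(d - r)) z :=
  2^-1 * Num.sqrt (L (S z)) * 'D_(col i V) (fun w => ln (L (S w))) z.

Let continuous_D i : continuous (D i).
Proof.
apply: (continuous_mulr (g := fun z => 2^-1 * Num.sqrt (F z))).
  apply: (continuous_mulr (g := fun=> 2^-1)); first exact: cst_continuous.
  exact: (continuous_sqrt_likelihood L_C1 S_C1).
exact: (continuous_derive_log_likelihood L_gt0 L_C1 S_C1).
Qed.

Let coord_D (a : 'cV[R]_r) :
  coord_C1 (fun b => Num.sqrt (F (U *m a + V *m b))) (fun i b => D i (U *m a + V *m b)).
Proof.
move=> i b; have E t : U *m a + V *m (b + t *: delta_mx i ord0) =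
    (U *m a + V *m b) + t *: col i V.
  by rewrite mulmxDr -scalemxAr -colE addrA.
split.
  under eq_fun do rewrite E.
  exact: (is_derive_sqrt_likelihood L_gt0 L_C1 S_C1).
have -> : (fun t : R => D i (U *m a + V *m (b + t *: delta_mx i ord0))) =
    (fun t : R => D i (U *m a + V *m b + t *: col i V)).
  by apply/funext => t; rewrite E.
move=> t.
apply: (@continuous_comp _ _ _ (fun t : R => U *m a + V *m b + t *: col i V) (D i)).
  apply: (@cvgD _ _ _ (nbhs t)); first exact: cvg_cst.
  exact: scalel_continuous.
exact: continuous_D.
Qed.

(** The factor [1/4] is the square of the [1/2] from differentiating the root; the sum over columns
    of [V] is the squared norm of [V^T] applied to the score. *)
Let D_energy z : \sum_(i < d - r) D i z ^+ 2 =
  4^-1 * (\tr (score L S z *m (score L S z)^T *m (V *m V^T)) * L (S z)).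
Proof.
have sE (s : 'cV[R]_d) :
    \tr (s *m s^T *m (V *m V^T)) = \sum_(i < d - r) ((V^T *m s) i ord0) ^+ 2.
  rewrite mulmxA mxtrace_mulC mulmxA mulmxA -mulmxA.
  rewrite (_ : s^T *m V = (V^T *m s)^T); last by rewrite trmx_mul trmxK.
  by move: (V^T *m s) => v; apply: eq_bigr => i _; rewrite mxE big_ord1 mxE expr2.
rewrite sE mulr_suml mulr_sumr; apply: eq_bigr => i _.
rewrite /D derive_log_likelihood_score// !exprMn sqr_sqrtr ?F0//.
have -> : \sum_j (col i V) j ord0 * score L S z j ord0 = (V^T *m score L S z) i ord0.
  by move: (score L S z) => s; rewrite mxE; apply: eq_bigr => j _; rewrite !mxE.
by field.
Qed.

Lemma hellinger_reduction_le :
  hellinger (posterior L S) (reduced_posterior L S U V) ^+ 2 <=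
  4^-1 * residual U (Hmat L S).
Proof.
rewrite hellinger_sqr.
have mD i : measurable_fun setT (D i).
  by apply: continuous_measurable_cV; exact: continuous_D.
have Foo : (\int[gauss d]_z (F z)%:E < +oo)%E.
  by rewrite -evidence_gauss; case/andP: Z_fin.
have := gauss_reduction_le_energy drk UU VV UV measurable_likelihood F0 mD coord_D Foo.
rewrite (residualE _ drk UU VV UV).
have -> : (\int[gauss d]_z (\sum_(i < d - r) D i z ^+ 2)%:E =
    (4^-1 * Z * \tr (Hmat L S *m (V *m V^T)))%:E)%E.
  have mD2 : measurable_fun setT (fun z => (\sum_(i < d - r) D i z ^+ 2)%:E).
    by apply/measurable_EFinP; apply: measurable_sum => i; exact: measurable_funX.
  have D20 z : (0 <= (\sum_(i < d - r) D i z ^+ 2)%:E)%E.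
    by rewrite lee_fin sumr_ge0// => i _; exact: sqr_ge0.
  rewrite (integral_gauss mD2 D20) EFinM -integral_score_form -integralZl//.
  apply: eq_integral => z _; rewrite D_energy -!EFinM; congr (_%:E).
  by rewrite /posterior -/Z; field; rewrite gt_eqF.
move=> le; have Zi0 : (0 <= (Z^-1)%:E)%E by rewrite lee_fin invr_ge0 ltW.
have := lee_wpmul2l Zi0 le; rewrite -integral_sqrt_posterior_err -!EFinM.
set X := (\int[_]_z _)%E; have X0 : (0 <= X)%E.
  by apply: integral_ge0 => z _; rewrite lee_fin sqr_ge0.
(* The factor 2 of the energy bound meets the [1/4] of the root; the [1/2] in the Hellinger distance
   then turns [1/2] into the final [1/4]. *)
have -> : Z^-1 * (2 * (4^-1 * Z * \tr (Hmat L S *m (V *m V^T)))) =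
    2^-1 * \tr (Hmat L S *m (V *m V^T)) by field; rewrite gt_eqF.
case: X X0 => [X| |]// _; rewrite !lee_fin /= => le2.
lra.
Qed.

End posterior_bounds.

(** * Stability of the posterior under a perturbation of the map *)

Section perturbed_posterior.
Context {R : realType} {d : nat}.
Variables (L : 'cV[R]_d -> R) (S S' : 'cV[R]_d -> 'cV[R]_d) (c : R).
Hypotheses (L_gt0 : forall x, 0 < L x) (L_C1 : C1 L) (S_C1 : C1 S) (S'_C1 : C1 S').
Hypotheses (le1 : forall z, L (S' z) <= expR c * L (S z))
           (le2 : forall z, L (S z) <= expR c * L (S' z)).

Lemma evidence_le (S1 S2 : 'cV[R]_d -> 'cV[R]_d) : C1 S1 -> C1 S2 ->
  (forall z, L (S1 z) <= expR c * L (S2 z)) ->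
  (evidence L S1 <= (expR c)%:E * evidence L S2)%E.
Proof.
move=> S1_C1 S2_C1 le12; rewrite !evidence_gauss//.
have mL (S0 : 'cV[R]_d -> 'cV[R]_d) : C1 S0 ->
    measurable_fun setT (fun z => (L (S0 z))%:E).
  by move=> ?; apply/measurable_EFinP; exact: measurable_likelihood.
have L0 (S0 : 'cV[R]_d -> 'cV[R]_d) z : (0 <= (L (S0 z))%:E)%E.
  by rewrite lee_fin ltW.
rewrite -(ge0_integralTZl _ (mL _ S2_C1) (L0 S2)) ?lee_fin ?expR_ge0//.
apply: ge0_le_integralT.
- exact: mL.
- exact: L0.
- by apply: emeasurable_funM; [exact: measurable_cst|exact: mL].
- by move=> z; rewrite -EFinM lee_fin.
Qed.

Hypothesis Z_fin : (0 < evidence L S < +oo)%E.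

Lemma perturbed_evidence_fin : (0 < evidence L S' < +oo)%E.
Proof.
case/andP: Z_fin => Z0 Zoo; apply/andP; split.
  have := lt_le_trans Z0 (evidence_le S_C1 S'_C1 le2).
  by rewrite pmule_rgt0// lte_fin expR_gt0.
apply: (le_lt_trans (evidence_le S'_C1 S_C1 le1)).
by rewrite lte_mul_pinfty// lee_fin expR_ge0.
Qed.

Lemma integral_posterior : (\int[lebesgue_cV d]_z (posterior L S z)%:E = 1)%E.
Proof.
have mL : measurable_fun setT (fun z => (L (S z))%:E).
  by apply/measurable_EFinP; exact: measurable_likelihood.
have L0 z : (0 <= (L (S z))%:E)%E by rewrite lee_fin ltW.
have Z0 : 0 < fine (evidence L S) by apply: fine_gt0.
have Zi0 : (0 <= ((fine (evidence L S))^-1)%:E)%E by rewrite lee_fin invr_ge0 ltW.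
have mLp : measurable_fun setT (fun z => (L (S z))%:E * (phi0 z)%:E)%E.
  apply: emeasurable_funM; first exact: mL.
  by apply/measurable_EFinP; exact: measurable_phi0.
have Lp0 z : (0 <= (L (S z))%:E * (phi0 z)%:E)%E.
  by rewrite mule_ge0// lee_fin; exact/ltW/phi0_gt0.
transitivity (((fine (evidence L S))^-1)%:E *
    \int[lebesgue_cV d]_z ((L (S z))%:E * (phi0 z)%:E))%E.
  rewrite -(ge0_integralTZl _ mLp Lp0 Zi0).
  by apply: eq_integral => z _; rewrite -!EFinM mulrA.
rewrite -(integral_gauss mL L0) -evidence_gauss//.
case/andP: Z_fin => Zp Zoo; rewrite -[X in (_ * X)%E]fineK ?gt0_fin_numE//.
by rewrite -EFinM mulVf// gt_eqF.
Qed.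

(** One factor [expR c] comes from the likelihoods, the other from the normalizing constants, which
    are compared in the opposite direction. *)
Lemma posterior_le (S1 S2 : 'cV[R]_d -> 'cV[R]_d) z : C1 S1 -> C1 S2 ->
  (0 < evidence L S1 < +oo)%E -> (0 < evidence L S2 < +oo)%E ->
  (forall z, L (S1 z) <= expR c * L (S2 z)) ->
  (forall z, L (S2 z) <= expR c * L (S1 z)) ->
  posterior L S1 z <= expR c ^+ 2 * posterior L S2 z.
Proof.
move=> S1_C1 S2_C1 Z1 Z2 le12 le21; rewrite /posterior.
have [Z10 Z20] : 0 < fine (evidence L S1) /\ 0 < fine (evidence L S2).
  by split; exact: fine_gt0.
have : (evidence L S2 <= (expR c)%:E * evidence L S1)%E by exact: evidence_le.
case/andP: Z1 => ? ?; case/andP: Z2 => ? ?.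
rewrite -(@fineK _ (evidence L S1)) ?gt0_fin_numE//.
rewrite -(@fineK _ (evidence L S2)) ?gt0_fin_numE//.
rewrite -EFinM lee_fin /=; move: (fine _) (fine _) Z10 Z20 => Z1 Z2 Z10 Z20 Z12.
rewrite mulrA ler_wpM2r ?(ltW (phi0_gt0 _))// expr2 mulrACA.
rewrite ler_pM ?invr_ge0 ?(ltW (L_gt0 _)) ?(ltW Z10)//.
by rewrite -[leLHS]mul1r ler_pdivrMr// mulrAC ler_pdivlMr// mul1r.
Qed.

Hypothesis c0 : 0 <= c.

(** Taking roots halves the exponent: the two roots are comparable up to [expR c], so they differ by
    at most [expR c - 1] times the root of [posterior L S], whose square has integral 1. The bound
    is quadratic in [c]. *)
Lemma integral_sqrt_perturbed_posterior :
  (\int[lebesgue_cV d]_z ((Num.sqrt (posterior L S z) -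
     Num.sqrt (posterior L S' z)) ^+ 2)%:E <= ((expR c - 1) ^+ 2)%:E)%E.
Proof.
have mp (S0 : 'cV[R]_d -> 'cV[R]_d) : C1 S0 -> measurable_fun setT (posterior L S0).
  by move=> ?; exact: measurable_posterior.
have p0 z := posterior_ge0 L_gt0 Z_fin z.
have Z'_fin := perturbed_evidence_fin.
have p0' z := posterior_ge0 L_gt0 Z'_fin z.
rewrite -[leRHS]mule1 -integral_posterior -ge0_integralTZl; last 3 first.
- by apply/measurable_EFinP; exact: mp.
- by move=> z; rewrite lee_fin p0.
- by rewrite lee_fin sqr_ge0.
apply: ge0_le_integralT.
- apply/measurable_EFinP; apply: measurable_funX; apply: measurable_funB;
    by apply: (measurableT_comp (@measurable_sqrt R)); exact: mp.
- by move=> z; rewrite lee_fin sqr_ge0.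
- by apply: emeasurable_funM; [exact: measurable_cst|apply/measurable_EFinP; exact: mp].
move=> z; rewrite -EFinM lee_fin.
have e1 : 1 <= expR c by rewrite -expR0 ler_expR.
have s1 : Num.sqrt (posterior L S z) <= expR c * Num.sqrt (posterior L S' z).
  rewrite -{1}(ger0_norm (expR_ge0 c)) -sqrtr_sqr -sqrtrM ?sqr_ge0// ler_wsqrtr//.
  exact: posterior_le.
have s2 : Num.sqrt (posterior L S' z) <= expR c * Num.sqrt (posterior L S z).
  rewrite -{1}(ger0_norm (expR_ge0 c)) -sqrtr_sqr -sqrtrM ?sqr_ge0// ler_wsqrtr//.
  exact: posterior_le.
rewrite -[X in _ <= _ * X](sqr_sqrtr (p0 z)) -exprMn.
move: (Num.sqrt _) (Num.sqrt _) (sqrtr_ge0 (posterior L S z))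
  (sqrtr_ge0 (posterior L S' z)) s1 s2.
move=> x x' x0 x'0 s1 s2.
rewrite -(ler_sqrt _ (sqr_ge0 _)) !sqrtr_sqr [leRHS]ger0_norm ?mulr_ge0 ?subr_ge0//.
rewrite ler_norml; apply/andP; split; nra.
Qed.

End perturbed_posterior.

(** * Lipschitz comparison of likelihoods and the two Hellinger bounds *)

Lemma ln_lipschitz_le (R : realType) n (L : 'cV[R]_n -> R) (C e : R)
    (x x' : 'cV[R]_n) :
  (forall x, 0 < L x) -> 0 <= C ->
  `|ln (L x) - ln (L x')| <= C * norm2 (x - x') -> norm2 (x - x') <= e ->
  L x <= expR (C * e) * L x' /\ L x' <= expR (C * e) * L x.
Proof.
move=> L0 C0 lip xe.
have : `|ln (L x) - ln (L x')| <= C * e by rewrite (le_trans lip)// ler_wpM2l.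
rewrite ler_norml => /andP[l1 l2].
by split; rewrite -[leLHS]lnK ?posrE// -[X in _ * X]lnK ?posrE// -expRD ler_expR; lra.
Qed.

(** From [expR (- c) >= 1 - c] one gets [expR c <= 1 / (1 - c)], which is at most [1 + 2 c] up to
    [c = 1/2]. *)
Lemma expR_sub1_le (R : realType) (c : R) : 0 <= c -> c <= 2^-1 -> expR c - 1 <= 2 * c.
Proof.
move=> c0 c1; have := expR_ge1Dx (- c); rewrite expRN => h.
have e0 := expR_gt0 c.
have : expR c * (1 - c) <= 1 by rewrite -ler_pdivlMl// mulr1.
nra.
Qed.

Theorem corollary4p3 (R : realType) (d m : nat)
    (f : 'cV[R]_d -> 'cV[R]_m -> R) (y : 'cV[R]_m)
    (T : 'cV[R]_d -> 'cV[R]_d) (pi0 : 'cV[R]_d -> R) (C : R)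
    (f_gt0 : forall x, 0 < f x y)
    (f_C1 : C1 (fun x => f x y))
    (T_C1 : C1 T) (T_bij : bijective T) (T_push : pushes_phi0_to T pi0)
    (Z_fin : (0 < evidence (fun x => f x y) T < +oo)%E)
    (C_gt0 : 0 < C)
    (f_lip : forall x x', `|ln (f x y) - ln (f x' y)| <= C * norm2 (x - x')) :
  (forall (eps : R) (That : 'cV[R]_d -> 'cV[R]_d) (r : nat)
      (Ur : 'M[R]_(d, r)) (Up : 'M[R]_(d, d - r)),
    0 < eps -> reduction_data (fun x => f x y) T eps That Ur Up ->
    hellinger (posterior (fun x => f x y) That)
        (reduced_posterior (fun x => f x y) That Ur Up) ^+ 2
      <= 4^-1 * residual Ur (Hmat (fun x => f x y) That)) /\
  (exists K : R, \forall eps \near 0^'+,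
    forall (That : 'cV[R]_d -> 'cV[R]_d) (r : nat)
      (Ur : 'M[R]_(d, r)) (Up : 'M[R]_(d, d - r)),
    reduction_data (fun x => f x y) T eps That Ur Up ->
    hellinger (posterior (fun x => f x y) T)
        (reduced_posterior (fun x => f x y) That Ur Up) ^+ 2
      <= 4^-1 * residual Ur (Hmat (fun x => f x y) That) + K * eps).
Proof.
set L := fun x => f x y.
have close eps (That : 'cV[R]_d -> 'cV[R]_d) : (forall z, norm2 (T z - That z) <= eps) ->
    (forall z, L (That z) <= expR (C * eps) * L (T z)) /\
    (forall z, L (T z) <= expR (C * eps) * L (That z)).
  move=> TT; split=> z; have [] :=
    ln_lipschitz_le f_gt0 (ltW C_gt0) (f_lip (T z) (That z)) (TT z).
    by move=> _.
  by [].
have part1 eps That r (Ur : 'M[R]_(d, r)) (Up : 'M[R]_(d, d - r)) :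
    reduction_data L T eps That Ur Up ->
    (0 < evidence L That < +oo)%E /\
    hellinger (posterior L That) (reduced_posterior L That Ur Up) ^+ 2
      <= 4^-1 * residual Ur (Hmat L That).
  move=> [[That_C1 _] /close[le1 le2] trH [rd [UU _]] [VV UV]].
  have Z'_fin := perturbed_evidence_fin f_gt0 f_C1 T_C1 That_C1 le1 le2 Z_fin.
  split=> //; exact: hellinger_reduction_le.
split=> [eps That r Ur Up _ /part1[]//|].
(* With [A] the reduction error and [B] the perturbation error, [eps A / 2 <= eps] because [A <= 2],
   which gives the 1. From [B <= 4 C^2 eps^2] comes [(1 + 1/eps) B / 2 <= 2 C^2 eps (1 + eps)], at
   most [4 C^2 eps] for [eps < 1]. *)
exists (1 + 4 * C ^+ 2); near=> eps => That r Ur Up red.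
have eps0 : 0 < eps by near: eps; exact: nbhs_right_gt.
have eps1 : eps < 1 by near: eps; exact: nbhs_right_lt.
(* This places [C eps] in the range of [expR_sub1_le]. *)
have epsC : eps < (2 * C)^-1 by near: eps; apply: nbhs_right_lt; rewrite invr_gt0 mulr_gt0.
have [Z'_fin] := part1 _ _ _ _ _ red.
case: red => [[That_C1 _] /close[le1 le2] trH [rd [UU _]] [VV UV]].
have Ceps0 : 0 <= C * eps by rewrite mulr_ge0 ?ltW.
have Ceps : C * eps <= 2^-1.
  by move: epsC; rewrite invfM ltr_pdivlMr// mulrC => /ltW.
have := integral_sqrt_perturbed_posterior f_gt0 f_C1 T_C1 That_C1 le1 le2 Z_fin Ceps0.
have := integral_sqrt_posterior_err_le2 f_gt0 f_C1 That_C1 Z'_fin rd UU VV UV.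
rewrite !hellinger_sqr.
set A := (\int[_]_z _)%E => A2; set B := (\int[_]_z _)%E => B2.
set X := (\int[_]_z _)%E => AR.
have A0 : (0 <= A)%E by apply: integral_ge0 => z _; rewrite lee_fin sqr_ge0.
have B0 : (0 <= B)%E by apply: integral_ge0 => z _; rewrite lee_fin sqr_ge0.
have X0 : (0 <= X)%E by apply: integral_ge0 => z _; rewrite lee_fin sqr_ge0.
have mp S0 : C1 S0 -> measurable_fun setT (fun z => Num.sqrt (posterior L S0 z)).
  move=> ?; apply: (measurableT_comp (@measurable_sqrt R)).
  exact: measurable_posterior.
have mq : measurable_fun setT (fun z => Num.sqrt (reduced_posterior L That Ur Up z)).
  apply: (measurableT_comp (@measurable_sqrt R)).
  exact: measurable_reduced_posterior.
have msq (u v : 'cV[R]_d -> R) : measurable_fun setT u -> measurable_fun setT v ->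
    measurable_fun setT (fun z => ((u z - v z) ^+ 2)%:E).
  by move=> ? ?; apply/measurable_EFinP; apply: measurable_funX; exact: measurable_funB.
(* Weighting by [eps] keeps the coefficient of [A] within [eps] of 1, so the constant [1/4]
   survives, at the price of a factor [1/eps] on [B], which is of order [eps^2]. *)
have XAB : (X <= (1 + eps)%:E * A + (1 + eps^-1)%:E * B)%E.
  have e1 : (0 <= (1 + eps)%:E)%E by rewrite lee_fin addr_ge0 ?ltW.
  have e2 : (0 <= (1 + eps^-1)%:E)%E by rewrite lee_fin addr_ge0 ?invr_ge0 ?ltW.
  have sq0 (x : R) : (0 <= (x ^+ 2)%:E)%E by rewrite lee_fin sqr_ge0.
  have mA := msq _ _ (mp _ That_C1) mq; have mB := msq _ _ (mp _ T_C1) (mp _ That_C1).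
  rewrite /A /B -(ge0_integralTZl _ mA (fun=> sq0 _) e1).
  rewrite -(ge0_integralTZl _ mB (fun=> sq0 _) e2).
  rewrite -ge0_integralTD; last 4 first.
  - by apply: emeasurable_funM; [exact: measurable_cst|exact: mA].
  - by move=> z; rewrite mule_ge0.
  - by apply: emeasurable_funM; [exact: measurable_cst|exact: mB].
  - by move=> z; rewrite mule_ge0.
  apply: ge0_le_integralT.
  - exact: msq (mp _ T_C1) mq.
  - by move=> z; exact: sq0.
  - apply: emeasurable_funD.
      by apply: emeasurable_funM; [exact: measurable_cst|exact: mA].
    by apply: emeasurable_funM; [exact: measurable_cst|exact: mB].
  move=> z; rewrite -!EFinM -EFinD lee_fin.
  move: (Num.sqrt _) (Num.sqrt _) (Num.sqrt _) => p' q p.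
  rewrite -subr_ge0.
  (* The gap in the weighted inequality is an exact square, since [p - q] is the sum of [p' - q] and
     [p - p']. *)
  have -> : (1 + eps) * (p' - q) ^+ 2 + (1 + eps^-1) * (p - p') ^+ 2 - (p - q) ^+ 2 =
      eps^-1 * (eps * (p' - q) - (p - p')) ^+ 2 by field; rewrite gt_eqF.
  by rewrite mulr_ge0 ?sqr_ge0// invr_ge0 ltW.
move: XAB AR A2 B2; case: A A0 => [a| |]//; case: B B0 => [b| |]//; case: X X0 => [x| |]//.
rewrite -!EFinM -EFinD !lee_fin /= => x0 b0 a0 xab ares a2 b2.
have bC : b <= (2 * (C * eps)) ^+ 2.
  apply: (le_trans b2); rewrite ler_sqr ?nnegrE ?mulr_ge0 ?expR_sub1_le//.
    by rewrite subr_ge0 -expR0 ler_expR.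
  exact: ltW.
have : (1 + eps^-1) * b <= (1 + eps^-1) * (2 * (C * eps)) ^+ 2.
  by apply: ler_wpM2l; [rewrite addr_ge0 ?invr_ge0 ?ltW|exact: bC].
have -> : (1 + eps^-1) * (2 * (C * eps)) ^+ 2 = 4 * C ^+ 2 * eps * (1 + eps).
  by field; rewrite gt_eqF.
have : 0 <= C ^+ 2 * eps by rewrite mulr_ge0 ?sqr_ge0 ?ltW.
nra.
Unshelve. all: by end_near.
Qed.
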